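(* Let $K$ be an infinite field and $n\ge2$. (i) A complete grid of lines $Y\subset\mathbb P^n_K$ of type $(\ell_1,\dots,\ell_n)$ with $\ell_1\cdots\ell_{k-1}\ell_{k+1}\cdots\ell_n>n$ for some $k$ is not seminormal. (ii) A complete pseudo-grid of lines in $\mathbb P^n_K$ that is obtained by a pseudo-$1$-lifting matrix $A$ such that, for any choice of $k$ entries $L_1,\dots,L_k$ of $A$, $\dim_K\langle L_1,\dots,L_k\rangle=\min\{n+1,k\}$, is a seminormal configuration of lines.
   Context: Let $\ell_1,\dots,\ell_n\ge1$, $S=K[x_1,\dots,x_n]$, $R=K[x_0,\dots,x_n]$. Complete grid: let $A_j\subset K$ have $\ell_j$ elements ($1\le j\le n$) and let $X\subset\mathbb P^n_K$ be the set of points with coordinates in $\{1\}\times A_1\times\cdots\times A_n$ (coordinates counted from $0$ to $n$). Let $p_{\infty,k}$ be the point whose only nonzero coordinate is the $k$-th one. The complete grid of lines of type $(\ell_1,\dots,\ell_n)$ with basis $X$ is the (reduced) union of the lines joining $p$ and $p_{\infty,k}$, for $p\in X$, $1\le k\le n$. Complete pseudo-grid: let $A=(L_{j,i})_{1\le j\le n,1\le i\le r}$, $r\ge\max_j\ell_j$, be a pseudo-$1$-lifting matrix, i.e. a matrix of linear forms in $R$ such that for all $1\le i_1,\dots,i_n\le r$ the space $\langle L_{1,i_1},\dots,L_{n,i_n}\rangle$ is $n$-dimensional; assume moreover that these spaces are pairwise distinct (condition required in the definition of complete pseudo-grid). The pseudo-$1$-lifting via $A$ of a monomial ideal $J\subset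 S$ with minimal monomial generators $\tau_1,\dots,\tau_s$ is the ideal $(\tilde\tau_1,\dots,\tilde\tau_s)\subset R$, where for $\tau=x_1^{\alpha_1}\cdots x_n^{\alpha_n}$ one sets $\tilde\tau=\prod_{j=1}^n\prod_{i=1}^{\alpha_j}L_{j,i}$. A complete pseudo-grid of type $(\ell_1,\dots,\ell_n)$ is the projective scheme defined by the pseudo-$1$-lifting via $A$ of $\Omega=(x_j^{\ell_j}x_k^{\ell_k}:1\le j<k\le n)$. ''Any choice of $k$ entries'' means entries in $k$ distinct positions of the matrix. A variety $X$ is seminormal if the local ring $\mathcal O_{X,p}$ is seminormal (in the sense of Traverso) for every point $p\in X$; a reduced Noetherian ring $B$ with finite integral closure $\overline B$ in its total ring of fractions is seminormal iff every $b\in\overline B$ with $b^2,b^3\in B$ lies in $B$. *)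

(* Defs.v *)
From HB Require Import structures.
From mathcomp Require Import all_boot all_order all_algebra.
From mathcomp Require Import ring.
From mathcomp Require Import finmap boolp classical_sets cardinality mpoly.

Set Implicit Arguments.
Unset Strict Implicit.
Unset Printing Implicit Defensive.

Import GRing.Theory.

Local Open Scope classical_set_scope.
Local Open Scope quotient_scope.
Local Open Scope ring_scope.

Record is_ideal (A : comNzRingType) (I : set A) : Prop := IsIdeal {
  ideal0 : I 0;
  idealD : forall x y, I x -> I y -> I (x + y);
  idealM : forall a x, I x -> I (a * x)
}.

Lemma smallest_ideal (A : comNzRingType) (G : set A) :
  is_ideal (smallest (@is_ideal A) G).
Proof.
split=> [J [[]]//|x y Ix Iy J [idJ sGJ]|a x Ix J [idJ sGJ]].
- by apply: (idealD idJ); [apply: Ix | apply: Iy].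
- by apply: (idealM idJ); apply: Ix.
Qed.

Lemma ideal_sum (A : comNzRingType) (I : set A) (T : Type) (s : seq T)
    (P : pred T) (F : T -> A) :
  is_ideal I -> (forall i, P i -> I (F i)) -> I (\sum_(i <- s | P i) F i).
Proof. by move=> idI IF; apply: (big_ind I); [case: idI | case: idI | ]. Qed.

(* Data for the ring of all [x.1 / x.2], [x] in [fd_frac], inside the
   localization of A / fd_ideal at the multiplicative set fd_den. *)
Record fracData (A : comNzRingType) := FracData {
  fd_ideal : set A;
  fd_den : set A;
  fd_frac : set (A * A);
  fd_idealP : is_ideal fd_ideal;
  fd_denM : forall s t, fd_den s -> fd_den t -> fd_den (s * t);
  fd_den_ideal : forall s, fd_den s -> ~ fd_ideal s;
  fd_frac_den : forall x, fd_frac x -> fd_den x.2;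
  fd_frac0 : fd_frac (0, 1);
  fd_frac1 : fd_frac (1, 1);
  fd_fracN : forall x, fd_frac x -> fd_frac (- x.1, x.2);
  fd_fracD : forall x y, fd_frac x -> fd_frac y ->
    fd_frac (x.1 * y.2 + y.1 * x.2, x.2 * y.2);
  fd_fracM : forall x y, fd_frac x -> fd_frac y ->
    fd_frac (x.1 * y.1, x.2 * y.2)
}.

Section Fractions.
Variables (A : comNzRingType) (F : fracData A).

Definition prefrac := {x : A * A | `[< fd_frac F x >]}.

Implicit Types x y z : prefrac.

Definition mk_prefrac (a : A * A) (h : fd_frac F a) : prefrac :=
  exist _ a (asboolT h).

Lemma prefracP x : fd_frac F (val x).
Proof. exact/asboolP/(valP x). Qed.

Definition equivf x y : bool :=
  `[< exists2 u, fd_den F u &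
      fd_ideal F (u * ((val x).1 * (val y).2 - (val y).1 * (val x).2)) >].

Lemma equivf_refl : reflexive equivf.
Proof.
move=> x; apply/asboolP; exists 1.
  exact: (fd_frac_den (fd_frac1 F)).
by rewrite subrr mulr0; exact: ideal0 (fd_idealP F).
Qed.

Lemma equivf_sym : ssrbool.symmetric equivf.
Proof.
move=> x y; apply/asboolP/asboolP=> -[u Uu Iu]; exists u => //;
  by rewrite -opprB mulrN -mulN1r; apply: idealM Iu; apply: fd_idealP.
Qed.

Lemma equivf_trans : transitive equivf.
Proof.
move=> y x z /asboolP[u Uu Iu] /asboolP[v Uv Iv]; apply/asboolP.
exists (u * v * (val y).2).
  by do 2?[apply: fd_denM=> //]; apply: fd_frac_den (prefracP y).
have idI := fd_idealP F.
have := idealD idI (idealM idI (v * (val z).2) Iu)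
                   (idealM idI (u * (val x).2) Iv).
by congr (fd_ideal F _); ring.
Qed.

Canonical equivf_equiv :=
  EquivRel equivf equivf_refl equivf_sym equivf_trans.

Definition fractions := {eq_quot equivf}.

HB.instance Definition _ : EqQuotient _ equivf fractions :=
  EqQuotient.on fractions.
HB.instance Definition _ := Choice.on fractions.

Definition mk_frac (a : A * A) (h : fd_frac F a) : fractions :=
  \pi_fractions (mk_prefrac h).

Lemma eq_pifrac x y :
  (val x).1 * (val y).2 = (val y).1 * (val x).2 ->
  \pi_fractions x = \pi_fractions y.
Proof.
move=> e; apply/eqmodP/asboolP; exists 1.
  exact: (fd_frac_den (fd_frac1 F)).
by rewrite e subrr mulr0; exact: ideal0 (fd_idealP F).
Qed.

Lemma equivf_repr x : exists2 u, fd_den F u & fd_ideal F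
  (u * ((val x).1 * (val (repr (\pi_fractions x))).2
        - (val (repr (\pi_fractions x))).1 * (val x).2)).
Proof.
have /eqmodP/asboolP[u Uu Iu] : x = repr (\pi_fractions x) %[mod fractions].
  by rewrite reprK.
by exists u.
Qed.

Definition addf x y := mk_prefrac (fd_fracD (prefracP x) (prefracP y)).
Definition mulf x y := mk_prefrac (fd_fracM (prefracP x) (prefracP y)).
Definition oppf x := mk_prefrac (fd_fracN (prefracP x)).

Definition addq := lift_op2 fractions addf.
Definition mulq := lift_op2 fractions mulf.
Definition oppq := lift_op1 fractions oppf.

Lemma pi_addq : {morph \pi : x y / addf x y >-> addq x y}.
Proof.
move=> x y; unlock addq; apply/eqmodP/asboolP.
have [u Uu Iu] := equivf_repr x; have [v Uv Iv] := equivf_repr y.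
exists (u * v); first exact: fd_denM.
set x' := repr _ in Iu *; set y' := repr _ in Iv *.
have idI := fd_idealP F.
have := idealD idI (idealM idI (v * (val y).2 * (val y').2) Iu)
                   (idealM idI (u * (val x).2 * (val x').2) Iv).
by congr (fd_ideal F _); rewrite /=; ring.
Qed.
Canonical pi_addq_morph := PiMorph2 pi_addq.

Lemma pi_mulq : {morph \pi : x y / mulf x y >-> mulq x y}.
Proof.
move=> x y; unlock mulq; apply/eqmodP/asboolP.
have [u Uu Iu] := equivf_repr x; have [v Uv Iv] := equivf_repr y.
exists (u * v); first exact: fd_denM.
set x' := repr _ in Iu *; set y' := repr _ in Iv *.
have idI := fd_idealP F.
have := idealD idI (idealM idI (v * (val y).1 * (val y').2) Iu)
                   (idealM idI (u * (val x').1 * (val x).2) Iv).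
by congr (fd_ideal F _); rewrite /=; ring.
Qed.
Canonical pi_mulq_morph := PiMorph2 pi_mulq.

Lemma pi_oppq : {morph \pi : x / oppf x >-> oppq x}.
Proof.
move=> x; unlock oppq; apply/eqmodP/asboolP.
have [u Uu Iu] := equivf_repr x; exists u => //.
set x' := repr _ in Iu *.
have := idealM (fd_idealP F) (- 1) Iu.
by congr (fd_ideal F _); rewrite /=; ring.
Qed.
Canonical pi_oppq_morph := PiMorph1 pi_oppq.

Definition zeroq : fractions := mk_frac (fd_frac0 F).
Definition oneq : fractions := mk_frac (fd_frac1 F).

Lemma addqA : associative addq.
Proof.
elim/quotW=> x; elim/quotW=> y; elim/quotW=> z; rewrite !piE.
by apply: eq_pifrac => /=; ring.
Qed.

Lemma addqC : commutative addq.
Proof.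
elim/quotW=> x; elim/quotW=> y; rewrite !piE.
by apply: eq_pifrac => /=; ring.
Qed.

Lemma add0q : left_id zeroq addq.
Proof. by elim/quotW=> x; rewrite !piE; apply: eq_pifrac => /=; ring. Qed.

Lemma addNq : left_inverse zeroq oppq addq.
Proof. by elim/quotW=> x; rewrite !piE; apply: eq_pifrac => /=; ring. Qed.

HB.instance Definition _ :=
  GRing.isZmodule.Build fractions addqA addqC add0q addNq.

Lemma mulqA : associative mulq.
Proof.
elim/quotW=> x; elim/quotW=> y; elim/quotW=> z; rewrite !piE.
by apply: eq_pifrac => /=; ring.
Qed.

Lemma mulqC : commutative mulq.
Proof.
elim/quotW=> x; elim/quotW=> y; rewrite !piE.
by apply: eq_pifrac => /=; ring.
Qed.

Lemma mul1q : left_id oneq mulq.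
Proof. by elim/quotW=> x; rewrite !piE; apply: eq_pifrac => /=; ring. Qed.

Lemma mulq_addl : left_distributive mulq addq.
Proof.
elim/quotW=> x; elim/quotW=> y; elim/quotW=> z; rewrite !piE.
by apply: eq_pifrac => /=; ring.
Qed.

Lemma nonzero1q : oneq != zeroq.
Proof.
apply/negP=> /eqP/eqmodP/asboolP[u Uu] /=.
by rewrite !mulr1 subr0 mulr1; apply: fd_den_ideal.
Qed.

HB.instance Definition _ := GRing.Zmodule_isComNzRing.Build fractions
  mulqA mulqC mul1q mulq_addl nonzero1q.

End Fractions.

Section Seminormal.
Variable B : comNzRingType.

Definition nonzerodivisor : set B := [set s | forall x, s * x = 0 -> x = 0].

Lemma is_ideal0 : is_ideal [set (0 : B)].
Proof.
by split=> [//|x y -> ->|a x ->] /=; rewrite ?addr0 ?mulr0.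
Qed.

Lemma nonzerodivisor1 : nonzerodivisor 1.
Proof. by move=> x; rewrite mul1r. Qed.

Lemma nonzerodivisorM s t :
  nonzerodivisor s -> nonzerodivisor t -> nonzerodivisor (s * t).
Proof. by move=> Ss St x; rewrite -mulrA => /Ss/St. Qed.

Lemma nonzerodivisor_neq0 s : nonzerodivisor s -> ~ [set (0 : B)] s.
Proof.
by move=> Ss /= s0; move: (Ss 1); rewrite s0 mul0r => /(_ erefl)/eqP;
  rewrite oner_eq0.
Qed.

Definition total_fracData : fracData B.
Proof.
refine (@FracData B [set 0] nonzerodivisor [set x | nonzerodivisor x.2]
  is_ideal0 nonzerodivisorM nonzerodivisor_neq0 _ _ _ _ _ _) => //.
- exact: nonzerodivisor1.
- exact: nonzerodivisor1.
- by move=> x y; apply: nonzerodivisorM.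
- by move=> x y; apply: nonzerodivisorM.
Defined.

Definition total_frac : comNzRingType := fractions total_fracData.

Definition to_total_frac (b : B) : total_frac :=
  @mk_frac B total_fracData (b, 1) nonzerodivisor1.

Definition reduced_ring : Prop := forall (x : B) (k : nat), x ^+ k = 0 -> x = 0.

(* For a reduced Noetherian ring whose integral closure in its total ring of
   fractions is finite, this is seminormality in the sense of Traverso. *)
Definition seminormal_ring : Prop :=
  reduced_ring /\
  forall q : total_frac, integralOver to_total_frac q ->
    range to_total_frac (q ^+ 2) -> range to_total_frac (q ^+ 3) ->
    range to_total_frac q.

End Seminormal.

Section Proj.
Variables (K : fieldType) (n : nat).
Local Notation R := {mpoly K[n.+1]}.

Definition homogeneous_ideal (I : set R) : Prop :=
  is_ideal I /\ forall f d, I f -> I (pihomog mdeg d f).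

Lemma smallest_homogeneous (G : set R) :
  (forall g, G g -> exists d, g \is d.-homog) ->
  homogeneous_ideal (smallest (@is_ideal R) G).
Proof.
move=> homG; set I := smallest _ _; have idI : is_ideal I.
  exact: smallest_ideal.
split=> // f d If; move: d.
suff /(_ f If) : I `<=` [set f | forall d, I (pihomog mdeg d f)] by [].
apply: smallest_sub => [|g Gg d] /=; last first.
  have [e hg] := homG g Gg; case: (eqVneq e d) => [<-|ned].
    by rewrite pihomog_dE //; apply: sub_gen_smallest.
  by rewrite (pihomog_ne0 ned hg); exact: ideal0 idI.
split=> [d|g h Jg Jh d|a g Jg d] /=.
- by rewrite pihomog0; exact: ideal0 idI.
- by rewrite pihomogD; exact: (idealD idI (Jg d) (Jh d)).
rewrite (pihomog_partitionE (leqnn (msize a))).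
rewrite (pihomog_partitionE (leqnn (msize g))).
rewrite big_distrl raddf_sum /=; refine (@ideal_sum _ I _ _ _ _ idI _) => i _ /=.
rewrite big_distrr raddf_sum /=; refine (@ideal_sum _ I _ _ _ _ idI _) => j _ /=.
have hij := dhomogM (pihomogP mdeg i a) (pihomogP mdeg j g).
case: (eqVneq (i + j)%N d) => [<-|ned].
  by rewrite pihomog_dE //; exact: (idealM idI _ (Jg j)).
by rewrite (pihomog_ne0 ned hij); exact: ideal0 idI.
Qed.

(* The closed subscheme Proj (R / eqns) of P^n. *)
Record proj_subscheme := ProjSubscheme {
  eqns :> set R;
  eqnsP : homogeneous_ideal eqns
}.

(* The points of the scheme P^n = Proj R. *)
Record proj_point := ProjPoint {
  pt :> set R;
  ptP : homogeneous_ideal pt;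
  pt_prime : forall f g, pt (f * g) -> pt f \/ pt g;
  pt_relevant : exists i, ~ pt 'X_i
}.

Section LocalRing.
Variables (Y : proj_subscheme) (P : proj_point).
Hypothesis YP : Y `<=` P.

Definition hden : set R := [set h | (exists d, h \is d.-homog) /\ ~ pt P h].

Definition hfrac : set (R * R) := [set x |
  (exists d, x.1 \is d.-homog /\ x.2 \is d.-homog) /\ ~ pt P x.2].

Lemma pt_proper : ~ pt P 1.
Proof.
move=> P1; have [i []] := pt_relevant P.
by rewrite -['X_i]mulr1; apply: idealM P1; case: (ptP P).
Qed.

Lemma pt_mul f g : ~ pt P f -> ~ pt P g -> ~ pt P (f * g).
Proof. by move=> Pf Pg /pt_prime[]. Qed.

Definition local_fracData : fracData R.
Proof.
refine (@FracData R Y hden hfrac (proj1 (eqnsP Y)) _ _ _ _ _ _ _ _).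
- move=> s t [[d hs] Ps] [[e ht] Pt]; split; last exact: pt_mul.
  by exists (d + e)%N; apply: dhomogM.
- by move=> s [_ Ps] /YP.
- by move=> x [[d [_ hd]] Px]; split=> //; exists d.
- split; last exact: pt_proper.
  by exists 0%N; split; [apply: dhomog0 | apply: dhomog1].
- split; last exact: pt_proper.
  by exists 0%N; split; apply: dhomog1.
- by move=> x [[d [h1 h2]] Px]; split=> //; exists d; split=> //=; rewrite rpredN.
- move=> x y [[d [hx1 hx2]] Px] [[e [hy1 hy2]] Py].
  split; last exact: pt_mul.
  exists (d + e)%N; split=> /=; last exact: dhomogM.
  by apply: rpredD; [|rewrite addnC]; apply: dhomogM.
- move=> x y [[d [hx1 hx2]] Px] [[e [hy1 hy2]] Py].
  split; last exact: pt_mul.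
  by exists (d + e)%N; split=> /=; apply: dhomogM.
Defined.

(* The stalk of the structure sheaf of Proj (R / Y) at P: the fractions f / g
   with f, g homogeneous of the same degree and g not in P. *)
Definition local_ring : comNzRingType := fractions local_fracData.

End LocalRing.

Definition seminormal (Y : proj_subscheme) : Prop :=
  forall (P : proj_point) (YP : Y `<=` P), seminormal_ring (local_ring YP).

Definition reduced (Y : proj_subscheme) : Prop :=
  forall (P : proj_point) (YP : Y `<=` P), reduced_ring (local_ring YP).

Definition linform (c : 'rV[K]_n.+1) : R := \sum_i c 0 i *: 'X_i.

Lemma linform_homog c : linform c \is 1.-homog.
Proof.
by apply: rpred_sum => i _; apply: dhomogZ; rewrite dhomogX; apply/eqP; exact: mdeg1.
Qed.

Definition vanishes_at (f : R) (p : 'rV[K]_n.+1) : Prop :=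
  f.@[fun i => p 0 i] = 0.

(* The ideal of the line joining the points of P^n with homogeneous
   coordinates p and q. *)
Definition line_ideal (p q : 'rV[K]_n.+1) : set R :=
  smallest (@is_ideal R) [set f | exists c,
    [/\ f = linform c, vanishes_at f p & vanishes_at f q]].

Lemma line_ideal_homogeneous p q : homogeneous_ideal (line_ideal p q).
Proof.
apply: smallest_homogeneous => g [c [-> _ _]].
by exists 1%N; apply: linform_homog.
Qed.

(* The reduced union of a finite set of lines. *)
Definition line_configuration (Y : proj_subscheme) : Prop :=
  reduced Y /\
  exists s : seq ('rV[K]_n.+1 * 'rV[K]_n.+1),
    (forall pq, pq \in s -> \rank (col_mx pq.1 pq.2) = 2%N) /\
    forall P : proj_point,
      Y `<=` P <-> exists2 pq, pq \in s & line_ideal pq.1 pq.2 `<=` P.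

Section Grid.
Variable A : 'I_n -> {fset K}.

Definition grid_basis : set 'rV[K]_n.+1 :=
  [set p | p 0 ord0 = 1 /\ forall j : 'I_n, p 0 (lift ord0 j) \in A j].

Definition pinf (k : 'I_n) : 'rV[K]_n.+1 := delta_mx 0 (lift ord0 k).

Definition grid_ideal : set R := [set f | forall p k,
  grid_basis p -> line_ideal p (pinf k) f].

Lemma grid_ideal_homogeneous : homogeneous_ideal grid_ideal.
Proof.
split=> [|f d If p k Xp]; last first.
  by apply: (proj2 (line_ideal_homogeneous _ _)); apply: If.
split=> [p k Xp|f g If Ig p k Xp|a f If p k Xp];
  have [idL _] := line_ideal_homogeneous p (pinf k).
- exact: ideal0 idL.
- exact: (idealD idL (If p k Xp) (Ig p k Xp)).
- exact: (idealM idL _ (If p k Xp)).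
Qed.

Definition complete_grid : proj_subscheme :=
  ProjSubscheme grid_ideal_homogeneous.

End Grid.

Section PseudoGrid.
Variables (r : nat) (A : 'I_n -> 'I_r -> 'rV[K]_n.+1).

Definition entry_span (i : 'I_r ^ n) : 'M[K]_n.+1 :=
  (\sum_(j < n) <<A j (i j)>>)%MS.

Definition pseudo_lifting_matrix : Prop :=
  forall i : 'I_r ^ n, \rank (entry_span i) = n.

Definition distinct_entry_spans : Prop :=
  forall i i' : 'I_r ^ n, i != i' -> ~~ (entry_span i == entry_span i')%MS.

Definition generic_entries : Prop := forall S : {set 'I_n * 'I_r},
  \rank (\sum_(x in S) <<A x.1 x.2>>)%MS = minn n.+1 #|S|.

(* Meaningful when all exponents of t are at most r. *)
Definition lift_monomial (t : 'X_{1..n}) : R :=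
  \prod_(j < n) \prod_(i < r | (i < t j)%N) linform (A j i).

Definition min_monomials (J : set {mpoly K[n]}) : set 'X_{1..n} :=
  [set t | J 'X_[t] /\ forall u, J 'X_[u] -> (u <= t)%MM -> u = t].

Definition pseudo_lifting_ideal (J : set {mpoly K[n]}) : set R :=
  smallest (@is_ideal R) [set lift_monomial t | t in min_monomials J].

Lemma lift_monomial_homog t : exists d, lift_monomial t \is d.-homog.
Proof.
apply/homogP; rewrite /lift_monomial.
have homM (p q : R) : p \is homog mdeg -> q \is homog mdeg -> p * q \is homog mdeg.
  move=> /homogP[d hp] /homogP[e hq]; apply/homogP.
  by exists (d + e)%N; apply: dhomogM.
have hom1 : (1 : R) \is homog mdeg by apply/homogP; exists 0%N; apply: dhomog1.
apply: (big_ind (fun p : R => p \is homog mdeg)) => // j _.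
apply: (big_ind (fun p : R => p \is homog mdeg)) => // i _.
by apply/homogP; exists 1%N; apply: linform_homog.
Qed.

Lemma pseudo_lifting_homogeneous J : homogeneous_ideal (pseudo_lifting_ideal J).
Proof.
by apply: smallest_homogeneous => _ [t _ <-]; apply: lift_monomial_homog.
Qed.

Definition pseudo_lifting (J : set {mpoly K[n]}) : proj_subscheme :=
  ProjSubscheme (pseudo_lifting_homogeneous J).

Definition Omega (l : 'I_n -> nat) : set {mpoly K[n]} :=
  smallest (@is_ideal {mpoly K[n]}) [set f | exists j k : 'I_n,
    (j < k)%N /\ f = 'X_j ^+ l j * 'X_k ^+ l k].

Definition complete_pseudo_grid (l : 'I_n -> nat) : proj_subscheme :=
  pseudo_lifting (Omega l).

End PseudoGrid.

End Proj.

(* Main.v *)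
(* Near a point, the class of a fraction is determined by its restrictions
   [f (p + t q)] to the lines of the configuration through that point.

   Grid: the lines through [p_oo,k] have directions [v_a] spanning a space of
   dimension at most [n], so if there are more than [n] of them the linear forms
   do not realize every family [(c_a t)_a].  For large [d] the forms of degree
   [d] do realize every family [(c_a t^d)_a], by interpolation.  For the largest
   [d] where this fails, a missing family has its square and cube in the local
   ring, but is not there itself.

   Pseudo-grid: by genericity the linear forms of [A] vanishing at a point are
   independent, so in suitable coordinates the configuration is, near the point,
   a union of coordinate axes through the origin (or a single line).  An element
   of the total ring of fractions whose square and cube are regular is regular on
   each axis, because [K[t]] is integrally closed; its values at the origin agree
   since their squares and cubes do, and functions on the axes that agree at the
   origin glue. *)
Require Import Defs.
From mathcomp Require Import all_boot all_order all_algebra.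
From mathcomp Require Import finmap boolp classical_sets cardinality mpoly.
From HB Require Import structures.
From mathcomp Require Import ring zify.

Set Implicit Arguments.
Unset Strict Implicit.
Unset Printing Implicit Defensive.

Import GRing.Theory.

Local Open Scope classical_set_scope.
Local Open Scope quotient_scope.
Local Open Scope ring_scope.

(** * Fractions *)

Section FractionTheory.
Variables (A : comNzRingType) (F : fracData A).

Lemma fracW (x : fractions F) : exists a (h : fd_frac F a), x = mk_frac h.
Proof.
elim/quotW: x => x; exists (val x), (prefracP x).
by apply: eq_pifrac.
Qed.

Lemma mk_frac_eqP (a b : A * A) (ha : fd_frac F a) (hb : fd_frac F b) :
  mk_frac ha = mk_frac hb <->
  exists2 u, fd_den F u & fd_ideal F (u * (a.1 * b.2 - b.1 * a.2)).
Proof.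
by split=> [/eqmodP/asboolP//|h]; apply/eqmodP/asboolP.
Qed.

Lemma mk_fracM (a b : A * A) (ha : fd_frac F a) (hb : fd_frac F b) :
  mk_frac ha * mk_frac hb =
  mk_frac (a := (a.1 * b.1, a.2 * b.2)) (fd_fracM ha hb).
Proof.
rewrite /mk_frac /GRing.mul /= !piE; exact: eq_pifrac.
Qed.

Lemma mk_frac0P (a : A * A) (ha : fd_frac F a) :
  mk_frac ha = 0 <-> exists2 u, fd_den F u & fd_ideal F (u * a.1).
Proof.
have -> : 0 = mk_frac (fd_frac0 F) :> fractions F by [].
by rewrite mk_frac_eqP /= mulr1 mul0r subr0.
Qed.

Lemma mk_fracX (a : A * A) (ha : fd_frac F a) k :
  exists h : fd_frac F (a.1 ^+ k, a.2 ^+ k), mk_frac ha ^+ k = mk_frac h.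
Proof.
elim: k => [|k [h IH]]; first by exists (fd_frac1 F).
by rewrite !exprS; exists (fd_fracM ha h); rewrite IH mk_fracM.
Qed.

(** The kernel of localization; as it is an ideal, inclusions into it can be tested on
    generators. *)
Lemma frac_zero_ideal :
  is_ideal [set f | exists2 u, fd_den F u & fd_ideal F (u * f)].
Proof.
have [I0 ID IM] := fd_idealP F; split=> /=.
- by exists 1; [exact: fd_frac_den (fd_frac1 F)|rewrite mulr0].
- move=> f g [u Uu If] [v Uv Ig]; exists (u * v); first exact: fd_denM.
  have -> : u * v * (f + g) = v * (u * f) + u * (v * g) by ring.
  by apply: ID; apply: IM.
- by move=> a f [u Uu If]; exists u => //; rewrite mulrCA; apply: IM.
Qed.

End FractionTheory.

Section TotalFraction.
Variable B : comNzRingType.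

Lemma total_fracW (q : total_frac B) :
  exists a s (hs : nonzerodivisor s),
    q = @mk_frac B (total_fracData B) (a, s) hs.
Proof. by have [[a s] [hs ->]] := fracW q; exists a, s, hs. Qed.

Lemma total_frac_eqP (a s b : B) (hs : nonzerodivisor s) :
  @mk_frac B (total_fracData B) (a, s) hs = to_total_frac b <-> a = b * s.
Proof.
rewrite /to_total_frac mk_frac_eqP /=; split=> [[u hu]|->].
  by rewrite mulr1 => /hu/eqP; rewrite subr_eq0 => /eqP.
by exists 1; [exact: nonzerodivisor1|rewrite mulr1 subrr mulr0].
Qed.

Lemma total_frac_expP (a s b : B) (hs : nonzerodivisor s) k :
  @mk_frac B (total_fracData B) (a, s) hs ^+ k = to_total_frac b <->
  a ^+ k = b * s ^+ k.
Proof.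
have [h ->] := @mk_fracX _ (total_fracData B) (a, s) hs k.
exact: (@total_frac_eqP _ _ _ h).
Qed.

(** [q] is a root of the monic polynomial X^2 - b, where b is the given square. *)
Lemma integralOver_square (q : total_frac B) :
  range (@to_total_frac B) (q ^+ 2) -> integralOver (@to_total_frac B) q.
Proof.
move=> [b _ qb]; exists ('X^2 - b%:P); first by rewrite monicXnsubC.
have to0 : to_total_frac 0 = 0 :> total_frac B by [].
have toN : to_total_frac (- b) = - to_total_frac b.
  by rewrite /to_total_frac /mk_frac /GRing.opp /= !piE; apply: eq_pifrac.
suff -> : map_poly (@to_total_frac B) ('X^2 - b%:P) =
          'X^2 - (to_total_frac b)%:P.
  by rewrite /root !hornerE qb subrr.
apply/polyP=> i; rewrite coef_map_id0 // !(coefB, coefXn, coefC).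
by case: i => [|[|[|i]]] /=; rewrite ?sub0r ?subr0 ?toN ?to0 ?oppr0.
Qed.

End TotalFraction.

(** * Restriction of forms to lines *)

(** A form is a linear combination of monomials of its degree, and a monomial of positive degree is
    a variable times a monomial of degree one less. *)
Lemma homog_ind (K : fieldType) (n : nat) (Q : nat -> {mpoly K[n]} -> Prop) :
  Q 0%N 1 -> (forall d, Q d 0) ->
  (forall d f g, Q d f -> Q d g -> Q d (f + g)) ->
  (forall d c f, Q d f -> Q d (c *: f)) ->
  (forall d i f, Q d f -> Q d.+1 ('X_i * f)) ->
  forall d f, f \is d.-homog -> Q d f.
Proof.
move=> Q1 Q0 QD QZ QX d f /dhomogP hf; rewrite [f]mpolyE big_seq.
apply: (big_ind (Q d)) => // [x y|m mf]; first exact: QD.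
apply: QZ; move: (hf m mf) => /=; move: m {mf hf f}.
elim: d => [|d IH] m; first by move/eqP; rewrite mdeg_eq0 => /eqP ->; rewrite mpolyX0.
move=> dm; have [i mi] : exists i, (0 < m i)%N.
  apply: contrapT => /forallNP m0; move: dm; rewrite mdegE big1 // => i _.
  by apply/eqP; rewrite -leqn0 leqNgt; apply/negP/m0.
have le_im : (U_(i) <= m)%MM by rewrite lep1mP -lt0n.
rewrite -(submK le_im) addmC mpolyXD; apply/QX/IH/eqP.
by rewrite -eqSS -dm -{2}(submK le_im) mdegD mdeg1 addn1.
Qed.

Section Restriction.
Variables (K : fieldType) (n : nat).
Local Notation R := {mpoly K[n.+1]}.
Implicit Types (f g h : R) (c p q : 'rV[K]_n.+1).

(** Pullback along t |-> p + t q. For independent [p], [q] this is the affine chart of their line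
    that omits only [q]. *)
Definition restr p q : R -> {poly K} :=
  mmap (@polyC K) (fun a => (p 0 a)%:P + q 0 a *: 'X).

HB.instance Definition _ p q :=
  GRing.RMorphism.copy (restr p q)
    (mmap (@polyC K) (fun a => (p 0 a)%:P + q 0 a *: 'X)).

Lemma restrX p q a : restr p q 'X_a = (p 0 a)%:P + q 0 a *: 'X.
Proof. by rewrite [LHS]mmapX mmap1U. Qed.

Lemma restrZ p q (a : K) f : restr p q (a *: f) = a *: restr p q f.
Proof. by rewrite [LHS]mmapZ mul_polyC. Qed.

Definition dotp c p : K := \sum_a c 0 a * p 0 a.

Lemma dotpE c p : dotp c p = (c *m p^T) 0 0.
Proof. by rewrite mxE; apply: eq_bigr => a _; rewrite mxE. Qed.

Lemma dotpDr c p q : dotp c (p + q) = dotp c p + dotp c q.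
Proof. by rewrite /dotp -big_split; apply: eq_bigr => a _; rewrite mxE mulrDr. Qed.

Lemma dotpZr c p a : dotp c (a *: p) = a * dotp c p.
Proof. by rewrite /dotp mulr_sumr; apply: eq_bigr => i _; rewrite mxE mulrCA. Qed.

Lemma dotpDl c c' p : dotp (c + c') p = dotp c p + dotp c' p.
Proof. by rewrite /dotp -big_split; apply: eq_bigr => a _; rewrite mxE mulrDl. Qed.

Lemma dotpZl a c p : dotp (a *: c) p = a * dotp c p.
Proof. by rewrite /dotp mulr_sumr; apply: eq_bigr => i _; rewrite mxE mulrA. Qed.

Lemma dotp_delta i p : dotp (delta_mx 0 i) p = p 0 i.
Proof.
rewrite /dotp (bigD1 i) //= mxE !eqxx mul1r big1 ?addr0 // => j /negbTE ji.
by rewrite mxE ji andbF mul0r.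
Qed.

Lemma vanishes_atE c p : vanishes_at (linform c) p <-> dotp c p = 0.
Proof.
rewrite /vanishes_at /linform raddf_sum /=.
by under eq_bigr do rewrite mevalZ mevalXU.
Qed.

Lemma restr_linform p q c :
  restr p q (linform c) = (dotp c p)%:P + dotp c q *: 'X.
Proof.
rewrite /linform raddf_sum /dotp raddf_sum scaler_suml -big_split /=.
by apply: eq_bigr => a _; rewrite restrZ restrX scalerDr scalerA -mul_polyC -polyCM.
Qed.

Lemma linformD c c' : linform (c + c') = linform c + linform c'.
Proof. by rewrite /linform -big_split; apply: eq_bigr => a _; rewrite mxE scalerDl. Qed.

Lemma linformZ (a : K) c : linform (a *: c) = a *: linform c.
Proof. by rewrite /linform scaler_sumr; apply: eq_bigr => i _; rewrite mxE scalerA. Qed.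

Lemma linform_delta a : linform (delta_mx 0 a) = 'X_a :> R.
Proof.
rewrite /linform (bigD1 a) //= mxE !eqxx scale1r big1 ?addr0 // => b /negbTE ba.
by rewrite mxE ba andbF scale0r.
Qed.

Lemma linform_mulmx m (w : 'rV[K]_m) (B : 'M[K]_(m, n.+1)) :
  linform (w *m B) = \sum_j w 0 j *: linform (row j B).
Proof.
rewrite mulmx_sum_row.
apply: (big_ind2 (fun u v => linform u = v)) => [|x y u v <- <-|i _].
- by rewrite /linform big1 // => a _; rewrite mxE scale0r.
- exact: linformD.
- exact: linformZ.
Qed.

Lemma ker_restr_ideal p q : is_ideal [set f | restr p q f = 0].
Proof.
split=> /= [|f g hf hg|a f hf]; first exact: rmorph0.
  by rewrite rmorphD /= hf hg addr0.
by rewrite rmorphM /= hf mulr0.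
Qed.

(** The hypothesis says dually that [p'] and [q'] lie in the span of [p] and [q]. *)
Lemma line_ideal_restr p q p' q' f :
  (forall c, dotp c p = 0 -> dotp c q = 0 -> dotp c p' = 0 /\ dotp c q' = 0) ->
  line_ideal p q f -> restr p' q' f = 0.
Proof.
move=> hc; suff: line_ideal p q `<=` [set f | restr p' q' f = 0] by apply.
apply: smallest_sub => [|_ [c [-> /vanishes_atE cp /vanishes_atE cq]]] /=.
  exact: ker_restr_ideal.
by rewrite restr_linform; have [-> ->] := hc c cp cq; rewrite scale0r addr0.
Qed.

End Restriction.

Lemma smallest_gen (A : comNzRingType) (G : set A) (x : A) :
  G x -> smallest (@is_ideal A) G x.
Proof. by move=> Gx J [_]; apply. Qed.

(** * Unions of coordinate axes *)

Section Axes.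
Variables (K : fieldType) (n : nat) (Y V : 'M[K]_n.+1).
Hypothesis VY : V^T *m Y = 1%:M.
Variables (o : 'I_n.+1) (C : {set 'I_n.+1}).
Hypothesis oC : o \notin C.
Local Notation R := {mpoly K[n.+1]}.
Implicit Types (f g h : R).

Local Notation y j := (linform (row j Y)).
Local Notation rho i := (restr (row o V) (row i V)).

(** The rows of [Y] are linear coordinates, those of [V] the dual frame of points; axis [i] joins
    the points [o] and [i]. *)
Lemma dotp_dual i j : dotp (row j Y) (row i V) = (j == i)%:R.
Proof.
rewrite dotpE tr_row -row_mul mxE [X in _ = X](_ : _ = (1%:M : 'M[K]_n.+1) j i).
  by rewrite -(mulmx1C VY) !mxE; apply: eq_bigr => a _; rewrite !mxE.
by rewrite mxE.
Qed.

Lemma X_coord a : 'X_a = \sum_j V j a *: y j.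
Proof.
rewrite -linform_delta -row1 -VY row_mul linform_mulmx.
by apply: eq_bigr => j _; rewrite !mxE.
Qed.

Lemma restr_coord i j :
  rho i (y j) = (j == o)%:R + (j == i)%:R *: 'X.
Proof. by rewrite restr_linform !dotp_dual polyC_natr. Qed.

(* The ideal of the union of the lines joining the point [o] of the dual frame
   to its points [i], [i \in C]. *)
Definition axes_ideal : set R :=
  smallest (@is_ideal R) [set f |
    (exists j, [/\ j \notin C, j != o & f = y j]) \/
    (exists i j, [/\ i \in C, j \in C, i != j & f = y i * y j])].

Lemma axes_idealP : is_ideal axes_ideal.
Proof. exact: smallest_ideal. Qed.

Lemma axes_restr i f : i \in C -> axes_ideal f -> rho i f = 0.
Proof.
move=> iC; suff: axes_ideal `<=` [set f | rho i f = 0] by apply.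
have io : i != o by apply: contraNneq oC => <-.
apply: smallest_sub => [|g [[j [jC jo ->]]|[i' [j [i'C jC ij ->]]]]] /=.
- exact: ker_restr_ideal.
- rewrite restr_coord (negbTE jo) (_ : j == i = false) ?scale0r ?addr0 //.
  by apply: contraNF jC => /eqP ->.
rewrite rmorphM /= !restr_coord.
have -> : i' == o = false by apply: contraNF oC => /eqP <-.
have -> : j == o = false by apply: contraNF oC => /eqP <-.
have [i'i|] := eqVneq i' i; last by rewrite scale0r addr0 mul0r.
by rewrite [j == i](_ : _ = false) ?scale0r ?addr0 ?mulr0 // -i'i eq_sym (negbTE ij).
Qed.

(** The nonconstant part of [w], homogenized: t becomes [y i], and powers of [y o], which restricts
    to 1, fill up the degree. *)
Definition tail d i (w : {poly K}) : R :=
  \sum_(k < d) w`_k.+1 *: (y i ^+ k.+1 * y o ^+ (d - k.+1)).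

Definition axes_lift d c (w : 'I_n.+1 -> {poly K}) : R :=
  c *: y o ^+ d + \sum_(i in C) tail d i (w i).

(** The gluing condition: the polynomials on the axes agree at the origin t = 0. The degree bound
    leaves room to homogenize in degree [d]. *)
Definition axes_data d c (w : 'I_n.+1 -> {poly K}) :=
  forall i, i \in C -> (w i)`_0 = c /\ (size (w i) <= d.+1)%N.

Lemma tail_homog d i w : tail d i w \is d.-homog.
Proof.
apply: rpred_sum => k _; apply: rpredZ.
have := dhomogM (dhomogMn k.+1 (linform_homog (row i Y)))
                (dhomogMn (d - k.+1) (linform_homog (row o Y))).
by rewrite !mul1n subnKC.
Qed.

Lemma axes_lift_homog d c w : axes_lift d c w \is d.-homog.
Proof.
apply: rpredD; last by apply: rpred_sum => i _; exact: tail_homog.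
by apply: rpredZ; rewrite -{2}[d]mul1n; apply/dhomogMn/linform_homog.
Qed.

(** On axis [i], [y o] is 1, [y i] is t and every other [y j] is 0, so besides the constant term
    only the tail of [i] contributes. *)
Lemma restr_axes_lift d c w : axes_data d c w ->
  forall i, i \in C -> rho i (axes_lift d c w) = w i.
Proof.
move=> hw i iC; have [w0 sw] := hw i iC.
have io : i == o = false by apply: contraNF oC => /eqP <-.
rewrite /axes_lift rmorphD /= restrZ rmorphXn /= restr_coord eqxx eq_sym io.
rewrite scale0r addr0 expr1n (bigD1 i) //= rmorphD /= [X in _ + (_ + X)]raddf_sum /=.
rewrite [X in _ + (_ + X)]big1 ?addr0 => [|j /andP[jC ji]].
  rewrite /tail raddf_sum /=.
  under eq_bigr => k _.
    rewrite restrZ rmorphM !rmorphXn /= !restr_coord eqxx io [o == i]eq_sym io.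
    rewrite scale0r scale1r addr0 add0r eqxx expr1n mulr1; over.
  have {2}-> : w i = \poly_(k < d.+1) (w i)`_k.
    apply/polyP=> k; rewrite coef_poly; case: ltnP => // /(leq_trans sw) kw.
    by rewrite nth_default.
  rewrite alg_polyC poly_def big_ord_recl expr0 alg_polyC w0.
  by congr (_ + _); apply: eq_bigr.
rewrite /tail raddf_sum big1 // => k _ /=.
rewrite restrZ rmorphM !rmorphXn /= !restr_coord (negbTE ji).
have -> : j == o = false by apply: contraNF oC => /eqP <-.
by rewrite scale0r addr0 expr0n mul0r scaler0.
Qed.

Definition axes_normal d f :=
  exists c w, axes_data d c w /\ axes_ideal (f - axes_lift d c w).

Lemma axes_normal0 d : axes_normal d 0.
Proof.
exists 0, (fun=> 0); split=> [i _|]; first by rewrite coef0 size_poly0.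
rewrite /axes_lift scale0r !add0r big1 ?oppr0; first by case: axes_idealP.
by move=> i _; rewrite /tail big1 // => k _; rewrite coef0 scale0r.
Qed.

Lemma axes_normalD d f g :
  axes_normal d f -> axes_normal d g -> axes_normal d (f + g).
Proof.
move=> [c [w [hw Jf]]] [c' [w' [hw' Jg]]].
exists (c + c'), (fun i => w i + w' i); split=> [i iC|].
  have [w0 sw] := hw i iC; have [w0' sw'] := hw' i iC.
  rewrite coefD w0 w0' (leq_trans (size_polyD _ _)) //.
  by rewrite geq_max sw sw'.
have -> : axes_lift d (c + c') (fun i => w i + w' i) =
          axes_lift d c w + axes_lift d c' w'.
  rewrite /axes_lift scalerDl addrACA -big_split /=; congr (_ + _).
  apply: eq_bigr => i _; rewrite /tail -big_split /=; apply: eq_bigr => k _.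
  by rewrite coefD scalerDl.
by rewrite opprD addrACA; apply: (idealD axes_idealP).
Qed.

Lemma axes_normalZ d a f : axes_normal d f -> axes_normal d (a *: f).
Proof.
move=> [c [w [hw Jf]]]; exists (a * c), (fun i => a *: w i); split=> [i iC|].
  have [w0 sw] := hw i iC.
  by rewrite coefZ w0 (leq_trans (size_scale_leq _ _)).
have -> : axes_lift d (a * c) (fun i => a *: w i) = a *: axes_lift d c w.
  rewrite /axes_lift scalerDr scalerA scaler_sumr; congr (_ + _).
  apply: eq_bigr => i _; rewrite /tail scaler_sumr; apply: eq_bigr => k _.
  by rewrite coefZ scalerA.
by rewrite -scalerBr -mul_mpolyC; apply: (idealM axes_idealP).
Qed.

Lemma axes_lift_mul_origin d c w : axes_data d c w ->
  y o * axes_lift d c w = axes_lift d.+1 c w.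
Proof.
move=> hw; rewrite /axes_lift mulrDr -scalerAr -exprS mulr_sumr; congr (_ + _).
apply: eq_bigr => i iC; have [_ sw] := hw i iC.
rewrite /tail big_ord_recr /= nth_default // scale0r addr0 mulr_sumr.
apply: eq_bigr => k _; rewrite -scalerAr subSS mulrCA -exprS.
by rewrite subnSK.
Qed.

(** Products [y i * y j] of distinct axis coordinates lie in the ideal, so only the part on axis [i]
    survives; the factor t there makes the constant term 0. *)
Lemma axes_lift_mul_axis d c w i : i \in C -> axes_data d c w ->
  axes_ideal (y i * axes_lift d c w -
    axes_lift d.+1 0 (fun j => if j == i then 'X * w i else 0)).
Proof.
move=> iC hw; have [w0 sw] := hw i iC.
have [J0 JD JM] := axes_idealP.
rewrite /axes_lift scale0r add0r (bigD1 i) //= [X in _ - X](bigD1 i) //= eqxx.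
rewrite [X in _ - (_ + X)]big1 ?addr0 => [|j /andP[_ /negbTE ->]]; last first.
  by rewrite /tail big1 // => k _; rewrite coef0 scale0r.
have -> : tail d.+1 i ('X * w i) = y i * (c *: y o ^+ d + tail d i (w i)).
  rewrite /tail big_ord_recl coefXM /= w0 expr1 subn1 /= mulrDr -scalerAr.
  congr (_ + _); rewrite mulr_sumr; apply: eq_bigr => k _.
  by rewrite coefXM /= -scalerAr mulrA -exprS.
rewrite addrA mulrDr addrAC subrr add0r mulr_sumr.
apply: (@ideal_sum _ axes_ideal) => // j /andP[jC ji].
rewrite /tail mulr_sumr; apply: (@ideal_sum _ axes_ideal) => // k _.
rewrite -mul_mpolyC (_ : _ * _ = ((w j)`_k.+1)%:MP * y j ^+ k * y o ^+ (d - k.+1) *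
  (y i * y j)); last by rewrite exprS; ring.
by apply: JM; apply: smallest_gen => /=; right; exists i, j; rewrite eq_sym.
Qed.

Lemma axes_normal_mul d j f : axes_normal d f -> axes_normal d.+1 (y j * f).
Proof.
have [J0 JD JM] := axes_idealP.
move=> [c [w [hw Jf]]]; have [->|jo] := eqVneq j o.
  exists c, w; split=> [i iC|].
    by have [w0 sw] := hw i iC; rewrite w0 (leq_trans sw).
  by rewrite -axes_lift_mul_origin // -mulrBr; apply: JM.
have [jC|jC] := boolP (j \in C); last first.
  have [c' [w' [hw' Jg]]] := axes_normal0 d.+1; exists c', w'; split=> //.
  rewrite -[y j * f]addr0 -addrA; apply: JD => //.
  by rewrite mulrC; apply: JM; apply: smallest_gen => /=; left; exists j.
exists 0, (fun i => if i == j then 'X * w j else 0); split=> [i iC|].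
  have [_|_] := eqVneq i j; last by rewrite coef0 size_poly0.
  have [w0 sw] := hw j jC; rewrite coefXM; split=> //.
  by rewrite (leq_trans (size_polyMleq _ _)) // size_polyX.
rewrite -[y j * f](subrK (y j * axes_lift d c w)) -addrA; apply: JD.
  by rewrite -mulrBr; apply: JM.
exact: axes_lift_mul_axis.
Qed.

Lemma homog_axes_normal d f : f \is d.-homog -> axes_normal d f.
Proof.
move: d f; apply: homog_ind.
- exists 1, (fun=> 1); split=> [i _|]; first by rewrite coefC size_polyC oner_eq0.
  rewrite /axes_lift expr0 scale1r big1 ?addr0 ?subrr => [|i _].
    by case: axes_idealP.
  by rewrite /tail big_ord0.
- exact: axes_normal0.
- exact: axes_normalD.
- exact: axes_normalZ.
move=> d a f nf; rewrite X_coord mulr_suml.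
apply: (big_ind (axes_normal d.+1)) => [|g h|j _]; first exact: axes_normal0.
- exact: axes_normalD.
by rewrite -scalerAl; apply/axes_normalZ/axes_normal_mul.
Qed.

(** The restrictions to the axes determine the normal form, which is therefore 0. The common
    constant term is read off on the axis [i0]. *)
Lemma axes_nullstellensatz d f i0 : i0 \in C -> f \is d.-homog ->
  (forall i, i \in C -> rho i f = 0) -> axes_ideal f.
Proof.
move=> i0C /homog_axes_normal[c [w [hw Jf]]] f0.
have w0 i : i \in C -> w i = 0.
  move=> iC; have := axes_restr iC Jf.
  by rewrite rmorphB /= f0 // restr_axes_lift // sub0r => /eqP; rewrite oppr_eq0 => /eqP.
have c0 : c = 0 by have [<- _] := hw i0 i0C; rewrite w0 // coef0.
suff l0 : axes_lift d c w = 0 by rewrite l0 subr0 in Jf.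
rewrite /axes_lift c0 scale0r add0r big1 // => i iC.
by rewrite /tail big1 // => k _; rewrite w0 // coef0 scale0r.
Qed.

End Axes.

(** * Seminormality of local rings of unions of axes *)

Lemma restr_at0 (K : fieldType) (n : nat) (p q : 'rV[K]_n.+1) f :
  (restr p q f).[0] = f.@[fun a => p 0 a].
Proof.
rewrite -[LHS]/(horner_eval 0 _) /restr /mmap /meval /mmap raddf_sum /=.
apply: eq_bigr => m _; rewrite rmorphM rmorph_prod /= /horner_eval hornerC.
congr (_ * _); apply: eq_bigr => a _.
by rewrite !hornerE.
Qed.

(** K[t] is integrally closed: if N/D = a/h in lowest terms, then a^2 H = A h^2, and h^2 is coprime
    to a^2. *)
Lemma divp_square (K : fieldType) (N D A H : {poly K}) :
  D != 0 -> N ^+ 2 * H = A * D ^+ 2 ->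
  exists a h, [/\ N * h = a * D, h != 0 & h ^+ 2 %| H].
Proof.
move=> D0 e; set g := gcdp N D.
have g0 : g != 0 by rewrite gcdp_eq0 negb_and D0 orbT.
pose a := N %/ g; pose h := D %/ g.
have eN : N = a * g by rewrite divpK // dvdp_gcdl.
have eD : D = h * g by rewrite divpK // dvdp_gcdr.
exists a, h; split.
- by rewrite eN eD; ring.
- by apply: contraNneq D0 => h0; rewrite eD h0 mul0r.
rewrite -(@Gauss_dvdpr _ _ (a ^+ 2)); last first.
  by rewrite coprimep_expl // coprimep_expr // coprimep_sym coprimep_div_gcd // D0 orbT.
apply/dvdpP; exists A; apply: (@mulIf _ (g ^+ 2)); first exact: expf_neq0.
transitivity (N ^+ 2 * H); first by rewrite eN; ring.
by rewrite e eD; ring.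
Qed.

Lemma eq_of_square_cube (K : fieldType) (x y : K) :
  x ^+ 2 = y ^+ 2 -> x ^+ 3 = y ^+ 3 -> x = y.
Proof.
have [->|x0] := eqVneq x 0.
  by rewrite expr0n => /esym/eqP; rewrite expf_eq0 => /eqP ->.
move=> e2 e3; apply: (mulfI (expf_neq0 2 x0)).
by rewrite -exprSr e3 e2 exprSr.
Qed.

Section LocalRing.
Variables (K : fieldType) (n : nat) (Z : proj_subscheme K n) (P : proj_point K n).
Hypothesis ZP : Z `<=` P.
Variables (Y V : 'M[K]_n.+1) (o : 'I_n.+1) (C : {set 'I_n.+1}) (i0 : 'I_n.+1).
Hypotheses (VY : V^T *m Y = 1%:M) (oC : o \notin C) (i0C : i0 \in C).
Local Notation R := {mpoly K[n.+1]}.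
Local Notation y j := (linform (row j Y)).
Local Notation rho i := (restr (row o V) (row i V)).
Local Notation F := (local_fracData ZP).
Local Notation B := (local_ring ZP).

Definition locally_zero : set R :=
  [set f | exists2 u, hden P u & eqns Z (u * f)].

Lemma locally_zero_ideal : is_ideal locally_zero.
Proof. exact: (frac_zero_ideal F). Qed.

(** Near [P], the scheme [Z] is the union of the axes in [C], and [P] lies on each of them but not
    on the hyperplane [y o] = 0. *)
Hypothesis P_o : ~ pt P (y o).
Hypothesis off_axes : forall j, j \notin C -> j != o -> locally_zero (y j).
Hypothesis axes_meet : forall i j, i \in C -> j \in C -> i != j ->
  locally_zero (y i * y j).
Hypothesis axes_in : forall i f, i \in C -> eqns Z f -> rho i f = 0.
Hypothesis P_on_axes : forall i j, i \in C -> j != o -> j != i -> pt P (y j).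

Let PI : is_ideal P := proj1 (ptP P).

(** The ideal of axis [i] is generated by the coordinates other than [y o] and [y i], all of which
    lie in [P]. *)
Lemma single_axis_in_pt i d f : i \in C -> f \is d.-homog -> rho i f = 0 -> pt P f.
Proof.
move=> iC hf f0; have oi : o \notin [set i]%SET.
  by rewrite finset.in_set1; apply: contraNneq oC => ->.
have : axes_ideal Y o [set i]%SET f.
  apply: (axes_nullstellensatz VY oi (set11 i) hf) => j.
  by rewrite finset.in_set1 => /eqP ->.
suff: axes_ideal Y o [set i]%SET `<=` P by apply.
apply: smallest_sub => // g [[j [ji jo ->]]|[j [k [ji ki jk _]]]].
  by apply: (P_on_axes iC jo); rewrite finset.in_set1 in ji.
by move: ji ki jk; rewrite !finset.in_set1 => /eqP -> /eqP ->; rewrite eqxx.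
Qed.

Lemma restr_neq0 i u : i \in C -> hden P u -> rho i u != 0.
Proof.
move=> iC [[d hu] Pu]; apply/eqP => u0; apply: Pu.
exact: single_axis_in_pt hu u0.
Qed.

(** Homogeneous elements outside [P] restrict to nonzero polynomials, and K[t] is a domain;
    conversely, the generators of the ideal of the axes are locally zero. *)
Lemma locally_zeroP d f : f \is d.-homog ->
  locally_zero f <-> forall i, i \in C -> rho i f = 0.
Proof.
move=> hf; split=> [[u Uu Zuf] i iC|f0].
  have /eqP := axes_in iC Zuf.
  by rewrite rmorphM mulf_eq0 (negbTE (restr_neq0 iC Uu)) => /eqP.
have : axes_ideal Y o C f by apply: (axes_nullstellensatz VY oC i0C hf f0).
suff: axes_ideal Y o C `<=` locally_zero by apply.
apply: smallest_sub => [|g [[j [jC jo ->]]|[i [j [iC jC ij ->]]]]].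
- exact: locally_zero_ideal.
- exact: off_axes.
- exact: axes_meet.
Qed.

(** Invertibility at [P] can be tested on one axis: the quotient of the restrictions lifts to a form
    [W], and once powers of [y o] balance the degrees, the difference of [h] and [g * W] vanishes on
    the axis, hence lies in [P]. *)
Lemma restr_dvd_notin_pt i d e h g : i \in C ->
  h \is d.-homog -> g \is e.-homog -> ~ pt P h -> rho i g %| rho i h -> ~ pt P g.
Proof.
move=> iC hh hg Ph /dvdpP[w ew] Pg.
have oi : o \notin [set i]%SET by rewrite finset.in_set1; apply: contraNneq oC => ->.
have [W hW eW] : exists2 W, W \is (size w).-homog & rho i W = w.
  exists (axes_lift Y o [set i]%SET (size w) w`_0 (fun=> w)).
    exact: axes_lift_homog.
  apply: (restr_axes_lift VY oi) => [j _|]; last exact: set11.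
  by split=> //; exact: leqnSn.
have yoi k : rho i (y o ^+ k) = 1.
  have /negbTE io : o != i by rewrite finset.in_set1 in oi.
  by rewrite rmorphXn /= restr_coord // eqxx io scale0r addr0 expr1n.
have hom : h * y o ^+ (e + size w) - g * W * y o ^+ d \is (d + (e + size w)).-homog.
  apply: rpredB.
    by apply: dhomogM => //; rewrite -[X in X.-homog]mul1n; apply/dhomogMn/linform_homog.
  rewrite addnC; apply: dhomogM; first exact: dhomogM.
  by rewrite -[X in X.-homog]mul1n; apply/dhomogMn/linform_homog.
have : pt P (h * y o ^+ (e + size w) - g * W * y o ^+ d).
  apply: (single_axis_in_pt iC hom).
  by rewrite rmorphB !rmorphM /= !yoi eW ew mulr1 mulr1 mulrC subrr.
move=> Pd; have : pt P (h * y o ^+ (e + size w)).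
  rewrite -(subrK (g * W * y o ^+ d) (h * _)); apply: (idealD PI) => //.
  by rewrite -mulrA mulrC; apply: (idealM PI).
case/pt_prime => //; elim: (e + size w)%N => [|k IH]; first exact: pt_proper.
by rewrite exprS => /pt_prime[].
Qed.

Lemma mk_local_eqP (a b : R * R) (ha : fd_frac F a) (hb : fd_frac F b) :
  mk_frac ha = mk_frac hb <->
  forall i, i \in C -> rho i a.1 * rho i b.2 = rho i b.1 * rho i a.2.
Proof.
have [[d [ha1 ha2]] _] := ha; have [[e [hb1 hb2]] _] := hb.
rewrite mk_frac_eqP.
have hom : a.1 * b.2 - b.1 * a.2 \is (d + e).-homog.
  by apply: rpredB; [|rewrite addnC]; apply: dhomogM.
split=> [|e0]; first move/(locally_zeroP hom) => e0 i iC.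
  by have /eqP := e0 i iC; rewrite rmorphB !rmorphM subr_eq0 => /eqP.
apply/(locally_zeroP hom) => i iC.
by rewrite rmorphB !rmorphM e0 ?subrr.
Qed.

Lemma local_reduced : reduced_ring B.
Proof.
move=> x k; have [a [ha ->]] := fracW x; have [h ->] := mk_fracX ha k.
have [[d [ha1 ha2]] Pa] := ha.
move=> /mk_frac0P x0; apply/mk_frac0P; apply/(locally_zeroP ha1) => i iC.
have /(locally_zeroP (dhomogMn k ha1)) /(_ i iC) /eqP := x0.
by rewrite rmorphXn expf_eq0 => /andP[_ /eqP].
Qed.

(** The fraction [y i / y o] is nonzero and vanishes on all axes other than [i], so a fraction
    vanishing on axis [i] kills it. *)
Lemma nonzerodivisor_restr (a : R * R) (ha : fd_frac F a) i : i \in C ->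
  nonzerodivisor (mk_frac ha) -> rho i a.1 != 0.
Proof.
move=> iC nz; have [[d [ha1 ha2]] Pa] := ha; apply/eqP => a0.
have io : i == o = false by apply: contraNF oC => /eqP <-.
have hE : fd_frac F (y i, y o).
  by split=> //; exists 1%N; split; apply: linform_homog.
have /mk_frac0P : mk_frac hE = 0.
  apply: nz; rewrite mk_fracM; apply/mk_frac0P.
  apply/(locally_zeroP (dhomogM ha1 (linform_homog _))) => j jC /=.
  rewrite rmorphM /= restr_coord // io.
  have [<-|_] := eqVneq i j; first by rewrite a0 mul0r.
  by rewrite scale0r addr0 mulr0.
move/(locally_zeroP (linform_homog _))/(_ i iC)/eqP.
by rewrite restr_coord // io eqxx scale1r add0r polyX_eq0.
Qed.

Lemma local_seminormal : seminormal_ring B.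
Proof.
split; first exact: local_reduced.
move=> q _ [b2 _ /esym e2] [b3 _ /esym e3].
have [f [s [nz_s eq_q]]] := total_fracW q; rewrite {}eq_q in e2 e3 *.
have {e2} /total_frac_expP e2 := e2; have {e3} /total_frac_expP e3 := e3.
have [[f1 g1] [hf ef]] := fracW f; have [[f2 g2] [hs es]] := fracW s.
have [[a2 h2] [hb2 eb2]] := fracW b2; have [[a3 h3] [hb3 eb3]] := fracW b3.
have [[d1 [/= f1h g1h]] /= Pg1] := hf; have [[d2 [/= f2h g2h]] /= Pg2] := hs.
have [[k2 [/= a2h h2h]] /= Ph2] := hb2; have [[k3 [/= a3h h3h]] /= Ph3] := hb3.
have hden_restr d u i : i \in C -> u \is d.-homog -> ~ pt P u -> rho i u != 0.
  by move=> iC hu Pu; apply: restr_neq0 => //; split=> //; exists d.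
(* On axis [i], [q] is the rational function [N i / D i]. *)
pose N i := rho i f1 * rho i g2; pose D i := rho i f2 * rho i g1.
have D0 i : i \in C -> D i != 0.
  move=> iC; apply: mulf_neq0; last exact: (hden_restr _ _ _ iC g1h Pg1).
  by apply: (nonzerodivisor_restr (ha := hs) iC); rewrite -es.
have E2 i : i \in C -> N i ^+ 2 * rho i h2 = rho i a2 * D i ^+ 2.
  move: e2; rewrite ef es eb2; have [hf' ->] := mk_fracX hf 2.
  have [hs' ->] := mk_fracX hs 2; rewrite mk_fracM => /mk_local_eqP e iC.
  have := e i iC; rewrite /= !(rmorphM, rmorphXn) /= => e'.
  transitivity (rho i f1 ^+ 2 * (rho i h2 * rho i g2 ^+ 2)); first by rewrite /N; ring.
  by rewrite e' /D; ring.
have E3 i : i \in C -> N i ^+ 3 * rho i h3 = rho i a3 * D i ^+ 3.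
  move: e3; rewrite ef es eb3; have [hf' ->] := mk_fracX hf 3.
  have [hs' ->] := mk_fracX hs 3; rewrite mk_fracM => /mk_local_eqP e iC.
  have := e i iC; rewrite /= !(rmorphM, rmorphXn) /= => e'.
  transitivity (rho i f1 ^+ 3 * (rho i h3 * rho i g2 ^+ 3)); first by rewrite /N; ring.
  by rewrite e' /D; ring.
(* Common constant terms let the numerators and denominators glue to forms [G] and [H]. As [h i]
   divides the restriction of [h2], which is not in [P], neither is [H]. *)
suff [a [h [c [c' hah]]]] : exists a h c c', forall i, i \in C ->
    [/\ N i * h i = a i * D i, h i %| rho i h2, (a i)`_0 = c & (h i)`_0 = c'].
  pose d := (\max_(i in C) maxn (size (a i)) (size (h i)))%N.
  have le_d i : i \in C -> (size (a i) <= d.+1)%N /\ (size (h i) <= d.+1)%N.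
    move=> iC; have : (maxn (size (a i)) (size (h i)) <= d)%N.
      exact: (leq_bigmax_cond (F := fun i => maxn (size (a i)) (size (h i))) _ iC).
    by rewrite geq_max => /andP[? ?]; rewrite !leqW.
  pose G := axes_lift Y o C d c a; pose H := axes_lift Y o C d c' h.
  have eG i : i \in C -> rho i G = a i.
    apply: restr_axes_lift => // j jC; have [_ _ ? _] := hah j jC.
    by split=> //; case: (le_d j jC).
  have eH i : i \in C -> rho i H = h i.
    apply: restr_axes_lift => // j jC; have [_ _ _ ?] := hah j jC.
    by split=> //; case: (le_d j jC).
  have hGH : fd_frac F (G, H).
    split; first by exists d; split; apply: axes_lift_homog.
    apply: (restr_dvd_notin_pt i0C h2h (axes_lift_homog Y o C d c' h) Ph2).
    by rewrite eH //; case: (hah i0 i0C).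
  exists (mk_frac hGH) => //; apply/esym/total_frac_eqP.
  rewrite ef es mk_fracM; apply/mk_local_eqP => i iC /=.
  rewrite !rmorphM /= eG // eH //; have [e _ _ _] := hah i iC.
  by transitivity (N i * h i); [rewrite /N; ring|rewrite e /D; ring].
have ex i : exists ah : {poly K} * {poly K}, i \in C ->
    [/\ N i * ah.2 = ah.1 * D i, ah.2 != 0 & ah.2 ^+ 2 %| rho i h2].
  have [iC|] := boolP (i \in C); last by exists (0, 0).
  have [a [h ?]] := divp_square (D0 i iC) (E2 i iC).
  by exists (a, h).
have [ah hah] := choice ex.
have dvd_h i : i \in C -> (ah i).2 %| rho i h2.
  move=> /hah[_ _]; apply: dvdp_trans; rewrite expr2; exact: dvdp_mulr.
(* With a single axis there is nothing to glue. *)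
have [[j1 j1C j1i0]|C1] := pselect (exists2 j, j \in C & j != i0); last first.
  exists (fun i => (ah i).1), (fun i => (ah i).2), ((ah i0).1)`_0, ((ah i0).2)`_0.
  move=> i iC; have -> : i = i0.
    by apply/eqP; apply: contra_notT C1 => ii0; exists i.
  by have [e _ _] := hah i0 i0C; split=> //; apply: dvd_h.
(* At least two axes pass through [P], so that [P] is the origin [o]. *)
have Py j : j != o -> pt P (y j).
  move=> jo; have [ji0|ji0] := eqVneq j i0; last exact: P_on_axes i0C jo ji0.
  by apply: (P_on_axes j1C jo); rewrite ji0 eq_sym.
have at0 i e u : i \in C -> u \is e.-homog -> ~ pt P u -> (rho i u).[0] != 0.
  move=> iC hu Pu; apply/negP => u0.
  have io : i != o by apply: contraNneq oC => <-.
  apply: (restr_dvd_notin_pt iC hu (linform_homog (row i Y)) Pu); last exact: Py.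
  rewrite restr_coord // (negbTE io) eqxx scale1r add0r.
  by rewrite -['X]subr0 -polyC0 dvdp_XsubCl.
have h0 i : i \in C -> ((ah i).2).[0] != 0.
  move=> iC; have /dvdpP[w ew] := dvd_h i iC.
  have := at0 i _ _ iC h2h Ph2; rewrite ew hornerM.
  by apply: contraNneq => ->; rewrite mulr0.
(* Scaling by [v i] makes every denominator 1 at the origin, so that only the values of the
   numerators remain to be compared. *)
pose v i := ((ah i).2).[0]^-1.
have vh i : i \in C -> v i * ((ah i).2).[0] = 1 by move=> iC; rewrite mulVf ?h0.
pose val u := u.@[fun a => (row o V) 0 a].
(* The [k]-th power of the value of [q] at the origin comes from one fraction x/z, so it is the same
   along every axis. *)
have pow k x z e : z \is e.-homog -> ~ pt P z ->
    (forall i, i \in C -> N i ^+ k * rho i z = rho i x * D i ^+ k) ->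
    forall i, i \in C -> (v i * ((ah i).1).[0]) ^+ k = val x / val z.
  move=> hz Pz E i iC; have [e1 _ _] := hah i iC.
  have vz : val z != 0 by rewrite /val -(restr_at0 _ (row i V)) (at0 _ e).
  have : (ah i).1 ^+ k * rho i z = rho i x * (ah i).2 ^+ k.
    apply: (mulIf (expf_neq0 k (D0 i iC))).
    by rewrite mulrAC -exprMn -e1 exprMn mulrAC E // mulrAC.
  move/(congr1 (horner^~ 0)); rewrite /= !hornerM !horner_exp !restr_at0 => e0.
  apply: (mulIf vz); rewrite divfK // exprMn -mulrA e0 mulrCA -exprMn vh //.
  by rewrite expr1n mulr1.
have sq := pow _ _ _ _ h2h Ph2 E2; have cu := pow _ _ _ _ h3h Ph3 E3.
exists (fun i => v i *: (ah i).1), (fun i => v i *: (ah i).2).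
exists (v i0 * ((ah i0).1).[0]), 1 => i iC; have [e _ _] := hah i iC; split.
- by rewrite -scalerAr e scalerAl.
- by rewrite dvdpZl ?dvd_h // invr_neq0 ?h0.
- rewrite coefZ -horner_coef0; apply: eq_of_square_cube.
    by rewrite !sq.
  by rewrite !cu.
by rewrite coefZ -horner_coef0 vh.
Qed.

End LocalRing.

(** * Pseudo-grids *)

Section LinearAlgebra.
Variables (K : fieldType) (n : nat).
Implicit Types c p q : 'rV[K]_n.+1.

(** The map from the first [m] unit vectors to the rows of [A] is injective, so it extends to an
    automorphism. *)
Lemma complete_rows m (A : 'M[K]_(m, n.+1)) (mn : (m <= n.+1)%N) :
  \rank A = m ->
  exists2 g : 'M[K]_n.+1, g \in unitmx &
    forall i, row (widen_ord mn i) g = row i A.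
Proof.
move=> rA; pose U : 'M[K]_(m, n.+1) := pid_mx m.
have UA : U *m ((pid_mx m : 'M_(n.+1, m)) *m A) = A.
  by rewrite mulmxA mul_pid_mx !minnn (minn_idPr mn) pid_mx_1 mul1mx.
have rU : \rank (U *m ((pid_mx m : 'M_(n.+1, m)) *m A)) = \rank U.
  by rewrite UA rA rank_pid_mx.
have [g ug Ug] := complete_unitmx rU; exists g => // i.
have -> : row i A = row i U *m g by rewrite -row_mul -Ug UA.
rewrite rowE; congr (_ *m g); apply/rowP=> j; rewrite !mxE eqxx /=.
by rewrite -(inj_eq val_inj) /= eq_sym ltn_ord andbT.
Qed.

Lemma linform_sub_ideal (I : set {mpoly K[n.+1]}) (T : finType) (S : {set T})
    (A : T -> 'rV[K]_n.+1) c : is_ideal I ->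
  (forall x, x \in S -> I (linform (A x))) ->
  (c <= \sum_(x in S) <<A x>>)%MS -> I (linform c).
Proof.
move=> idI IA /sub_sumsmxP[u ->].
have -> : linform (\sum_(x in S) u x *m <<A x>>%MS) =
          \sum_(x in S) linform (u x *m <<A x>>%MS).
  apply: (big_morph _ (@linformD K n)).
  by rewrite /linform big1 // => a _; rewrite mxE scale0r.
apply: (@ideal_sum _ I) => // x xS.
have /submxP[D ->] : (u x *m <<A x>> <= A x)%MS.
  by rewrite (submx_trans (submxMl _ _)) // genmxE.
rewrite linform_mulmx big_ord_recl big_ord0 addr0 -mul_mpolyC.
by apply: (idealM idI); rewrite row_id; apply: IA.
Qed.

Lemma line_of_forms m (B : 'M[K]_(m, n.+1)) : (\rank B).+1 = n ->
  exists pq : 'rV[K]_n.+1 * 'rV[K]_n.+1,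
    \rank (col_mx pq.1 pq.2) = 2%N /\
    forall c, (dotp c pq.1 = 0 /\ dotp c pq.2 = 0) <-> (c <= B)%MS.
Proof.
(* The rows of [W] span the common zeros of the forms in [B], a space of dimension (n + 1) - (n - 1)
   = 2. *)
move=> rB; pose W := (cokermx B)^T.
have rW : \rank W = 2%N.
  rewrite mxrank_tr mxrank_coker; move: (\rank B) rB => k <-.
  by rewrite -addn2 addKn.
pose p := row (cast_ord (esym rW) ord0) (row_base W).
pose q := row (cast_ord (esym rW) (@ord_max 1)) (row_base W).
have eqW : (col_mx p q :=: W)%MS.
  apply: eqmx_trans (eq_row_base W); apply/eqmxP/andP; split.
    by rewrite col_mx_sub !row_sub.
  apply/row_subP => i; have : (i < 2)%N by rewrite -[X in (_ < X)%N]rW.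
  move=> i2; rewrite -(addsmxE p q).
  have [i0|i1] := eqVneq (val i) 0%N.
    rewrite (_ : i = cast_ord (esym rW) ord0) ?addsmxSl //; exact: val_inj.
  rewrite (_ : i = cast_ord (esym rW) (@ord_max 1)) ?addsmxSr //.
  by apply/val_inj/eqP; rewrite eqn_leq -ltnS i2 lt0n.
exists (p, q); split=> [|c]; first by rewrite eqW.
have dot0 u : dotp c u = 0 <-> c *m u^T = 0.
  rewrite dotpE; split=> [e|->]; last by rewrite mxE.
  by apply/matrixP=> i j; rewrite !ord1 e mxE.
have colE : (c *m (col_mx p q)^T = 0) <-> (c *m p^T = 0 /\ c *m q^T = 0).
  rewrite tr_col_mx mul_mx_row; split=> [|[-> ->]]; last by rewrite row_mx0.
  by rewrite -(row_mx0 K 1 1 1) => /eq_row_mx.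
rewrite /= !dot0 -colE submxE -[cokermx B]trmxK -/W.
split=> [e|/eqP e].
  have /submxP[D ->] : (W <= col_mx p q)%MS by rewrite eqW.
  by rewrite trmx_mul mulmxA e mul0mx.
have /submxP[D ->] : (col_mx p q <= W)%MS by rewrite eqW.
by rewrite trmx_mul mulmxA e mul0mx.
Qed.

End LinearAlgebra.

(** * Generators of the ideal of a pseudo-grid *)

Section PseudoGridEquations.
Variables (K : fieldType) (n r : nat) (A : 'I_n -> 'I_r -> 'rV[K]_n.+1).
Variable l : 'I_n -> nat.
Hypothesis l_gt0 : forall j, (0 < l j)%N.

Definition row_product j : {mpoly K[n.+1]} :=
  \prod_(i < r | (i < l j)%N) linform (A j i).

Definition cross (j k : 'I_n) : 'X_{1..n} := (U_(j) *+ l j + U_(k) *+ l k)%MM.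

Lemma crossE j k i : j != k ->
  cross j k i = (if i == j then l j else if i == k then l k else 0)%N.
Proof.
move=> jk; rewrite mnmDE !mulmnE !mnm1E (eq_sym j i) (eq_sym k i).
have [->|ij] := eqVneq i j; first by rewrite (negbTE jk) mul1n addn0.
by rewrite mul0n add0n; have [_|_] := eqVneq i k; rewrite ?mul1n ?mul0n.
Qed.

Lemma crossC j k : cross j k = cross k j.
Proof. exact: addmC. Qed.

(** The polynomials all of whose monomials satisfy the conclusion form an ideal that contains the
    generators of [Omega]. *)
Lemma Omega_monomial t : @Omega K n l 'X_[t] ->
  exists j k : 'I_n, [/\ j != k, (l j <= t j)%N & (l k <= t k)%N].
Proof.
pose J : set {mpoly K[n]} := [set f | forall t, t \in msupp f ->
  exists j k : 'I_n, [/\ j != k, (l j <= t j)%N & (l k <= t k)%N]].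
suff /[apply] : @Omega K n l `<=` J by apply; rewrite msuppX mem_seq1.
apply: smallest_sub => [|_ [j [k [jk ->]]] u] /=; last first.
  rewrite !mpolyXn -mpolyXD msuppX mem_seq1 => /eqP ->.
  exists j, k; have njk : j != k by rewrite neq_ltn jk.
  by rewrite -/(cross j k) !crossE // !eqxx (eq_sym k) (negbTE njk).
split=> [u|f g Jf Jg u|a f Jf u]; first by rewrite msupp0.
  by move/msuppD_le; rewrite mem_cat => /orP[/Jf|/Jg].
case/msuppM_le/allpairsP => -[u1 u2] /= [_ /Jf[j [k [jk lj lk]]] ->].
by exists j, k; rewrite !mnmDE !(leq_trans _ (leq_addl _ _)).
Qed.

Lemma Omega_cross j k : j != k -> @Omega K n l 'X_[cross j k].
Proof.
wlog: j k / (j < k)%N => [wlog|jk _].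
  rewrite neq_ltn => /orP[|] jk; last rewrite crossC;
  by apply: wlog => //; rewrite neq_ltn jk.
by apply: smallest_gen => /=; exists j, k; rewrite mpolyXD -!mpolyXn.
Qed.

Lemma min_monomials_Omega t :
  min_monomials (@Omega K n l) t <-> exists j k, j != k /\ t = cross j k.
Proof.
have cross_le (j k : 'I_n) (u : 'X_{1..n}) : j != k -> (l j <= u j)%N -> (l k <= u k)%N ->
    (cross j k <= u)%MM.
  move=> jk lj lk; apply/mnm_lepP => i; rewrite crossE //.
  by case: eqP => [->|_] //; case: eqP => [->|].
split=> [[/Omega_monomial[j [k [jk lj lk]]] tmin]|[j [k [jk ->]]]].
  exists j, k; split=> //; apply/esym/tmin; first exact: Omega_cross.
  exact: cross_le.
split; first exact: Omega_cross.
move=> u /Omega_monomial[j' [k' [jk' lj' lk']]] /mnm_lepP ule.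
(* As [l i] is positive, such an index lies in the support of [cross j k]; so a monomial of [Omega]
   dividing the cross involves the same two indices. *)
have mem i : (l i <= u i)%N -> (i == j) || (i == k).
  move=> liu; have := leq_trans (l_gt0 i) (leq_trans liu (ule i)).
  by rewrite crossE //; case: eqP => //; case: eqP.
have [lj lk] : (l j <= u j)%N /\ (l k <= u k)%N.
  move: jk'; have /orP[/eqP ej|/eqP ej] := mem j' lj';
  have /orP[/eqP ek|/eqP ek] := mem k' lk'; subst j' k'; rewrite ?eqxx //.
have /mnm_lepP cu := cross_le j k u jk lj lk.
by apply/mnmP => i; apply/eqP; rewrite eqn_leq cu ule.
Qed.

Lemma lift_monomial_cross j k : j != k ->
  lift_monomial A (cross j k) = row_product j * row_product k.
Proof.
move=> jk; have kj : k != j by rewrite eq_sym.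
rewrite /lift_monomial (bigD1 j) //= (bigD1 k kj) /=.
rewrite [X in _ * (_ * X)]big1 => [|i /andP[ij ik]].
  rewrite mulr1; congr (_ * _); apply: eq_bigl => i; rewrite crossE // eqxx //.
  by rewrite (negbTE kj).
by rewrite big_pred0 // => a; rewrite crossE // (negbTE ij) (negbTE ik).
Qed.

Lemma complete_pseudo_grid_gen j k : j != k ->
  eqns (complete_pseudo_grid A l) (row_product j * row_product k).
Proof.
move=> jk; rewrite -lift_monomial_cross //; apply: smallest_gen => /=.
by exists (cross j k) => //; apply/min_monomials_Omega; exists j, k.
Qed.

Lemma complete_pseudo_grid_sub (I : set {mpoly K[n.+1]}) : is_ideal I ->
  (forall j k, j != k -> I (row_product j * row_product k)) ->
  complete_pseudo_grid A l `<=` I.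
Proof.
move=> idI hI; apply: smallest_sub => // _ [t /min_monomials_Omega[j [k [jk ->]]] <-].
by rewrite lift_monomial_cross //; apply: hI.
Qed.

End PseudoGridEquations.

(** * Rows of the matrix met by a set of entries *)

Section RowSets.
Variables n r : nat.
Implicit Types E : {set 'I_n * 'I_r}.

Definition row_set E : {set 'I_n} := [set x.1 | x in E]%SET.

Lemma row_set_free E : (#|row_set E| < n)%N -> exists k, k \notin row_set E.
Proof.
move=> ltE; apply: contrapT => /forallNP all_in; move: ltE.
suff -> : row_set E = [set: 'I_n]%SET by rewrite cardsT card_ord ltnn.
by apply/finset.setP=> k; rewrite finset.in_setT; apply/negPn/negP/all_in.
Qed.

(** The complement of [row_set E] has at most one element. *)
Lemma row_set_two E j k : (n <= #|row_set E|.+1)%N -> j != k ->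
  j \in row_set E \/ k \in row_set E.
Proof.
move=> leE jk; apply: contrapT => /not_orP[/negP jE /negP kE].
have : row_set E \subset ~: [set j; k]%SET.
  apply/fintype.subsetP => i iE; rewrite finset.in_setC finset.in_set2.
  by apply/norP; split; [apply: contraNneq jE|apply: contraNneq kE] => <-.
move/subset_leq_card; have := cardsC [set j; k]%SET.
rewrite cards2 jk card_ord; lia.
Qed.

Lemma row_set_leq E : (#|row_set E| <= #|E|)%N.
Proof. exact: leq_imset_card. Qed.

Lemma row_set_mono E E' :
  E \subset E' -> (#|row_set E| <= #|row_set E'|)%N.
Proof. by move=> EE'; apply/subset_leq_card/imsetS. Qed.

Lemma row_setD1_same E x z :
  z \in E -> z != x -> z.1 = x.1 -> row_set E = row_set (E :\ x)%SET.
Proof.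
move=> zE zx e; apply/finset.setP => j; apply/imsetP/imsetP => -[y yE ->].
  have [->|yx] := eqVneq y x; last by exists y => //; rewrite finset.in_setD1 yx.
  by exists z => //; rewrite finset.in_setD1 zx.
by exists y => //; move: yE; rewrite finset.in_setD1 => /andP[].
Qed.

End RowSets.

(** * The local ring of a pseudo-grid at a point *)

Section PseudoGridPoint.
Variables (K : fieldType) (n r : nat) (A : 'I_n -> 'I_r -> 'rV[K]_n.+1).
Variable l : 'I_n -> nat.
Hypothesis n_ge2 : (2 <= n)%N.
Hypothesis l_gt0 : forall j, (0 < l j)%N.
Hypothesis gen : generic_entries A.
Variable P : proj_point K n.
Hypothesis ZP : complete_pseudo_grid A l `<=` P.
Local Notation form x := (linform (A x.1 x.2)).
Local Notation T := (row_product A l).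

Let PI : is_ideal P := proj1 (ptP P).

Lemma prod_notin_pt (I : finType) (Q : pred I) (G : I -> {mpoly K[n.+1]}) :
  (forall i, Q i -> ~ pt P (G i)) -> ~ pt P (\prod_(i | Q i) G i).
Proof.
move=> PG; apply: (big_ind (fun f => ~ pt P f)) => //; first exact: pt_proper.
exact: pt_mul.
Qed.

(** The bound on the column selects the entries that occur in the products [T j]. *)
Definition pt_entries : {set 'I_n * 'I_r} :=
  [set x : 'I_n * 'I_r | (x.2 < l x.1)%N && `[< pt P (form x) >]]%SET.
Local Notation S := pt_entries.

Lemma pt_entriesP x : x \in S <-> (x.2 < l x.1)%N /\ pt P (form x).
Proof.
by rewrite finset.in_set; split=> [/andP[? /asboolP]|[-> /asboolP]].
Qed.

Lemma row_product_in_pt j : pt P (T j) -> exists i, (j, i) \in S.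
Proof.
move=> PT; apply: contrapT => nS; apply: (prod_notin_pt _ PT) => i ij Pi.
by apply: nS; exists i; apply/pt_entriesP.
Qed.

(** [P] is prime and contains all products [T j * T k], so at most one [T k] lies outside it. *)
Lemma rows_covered : exists k, forall j, j != k -> exists i, (j, i) \in S.
Proof.
have [Tall|/existsNP[k Tk]] := pselect (forall k, pt P (T k)).
  by exists (Ordinal (ltnW n_ge2)) => j _; apply/row_product_in_pt/Tall.
exists k => j jk; apply: row_product_in_pt.
by have /ZP/pt_prime[] := complete_pseudo_grid_gen (A := A) l_gt0 jk.
Qed.

(** The entries vanishing at [P] are independent by genericity, and a variable not vanishing at [P]
    is independent of them. Together they extend to coordinates [Y], with this variable as row 0 and
    the entry [x] as row [e x]. *)
Lemma pt_frame : (#|S| <= n)%N /\ exists (Y V : 'M[K]_n.+1) (e : 'I_n * 'I_r -> 'I_n.+1),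
  [/\ V^T *m Y = 1%:M, ~ pt P (linform (row ord0 Y)), {in S &, injective e} &
      forall x, x \in S -> e x != ord0 /\ row (e x) Y = A x.1 x.2].
Proof.
have [a Pa] := pt_relevant P; pose u : 'rV[K]_n.+1 := delta_mx 0 a.
pose span := (\sum_(x in S) <<A x.1 x.2>>)%MS.
have uS : ~~ (u <= span)%MS.
  apply/negP => uS; apply: Pa; rewrite -linform_delta.
  apply: (linform_sub_ideal PI _ uS) => x; by case/pt_entriesP.
(* By genericity, more than [n] entries would span all linear forms, including [u]. *)
have le_S : (#|S| <= n)%N.
  rewrite leqNgt; apply: contra uS => ltS; apply: submx_full.
  by rewrite /row_full gen (minn_idPl ltS).
pose entry (i : 'I_#|S|) := A (enum_val i).1 (enum_val i).2.
split=> //; pose B : 'M[K]_(#|S|, n.+1) := \matrix_(i < #|S|) entry i.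
have eqB : (B :=: span)%MS.
  apply/eqmxP/andP; split.
    apply/row_subP => i; rewrite rowK.
    by apply: (sumsmx_sup (enum_val i)); [exact: enum_valP|rewrite genmxE].
  apply/sumsmx_subP => x xS; rewrite genmxE.
  have -> : A x.1 x.2 = row (enum_rank_in xS x) B.
    by rewrite rowK /entry enum_rankK_in.
  exact: row_sub.
have rB : \rank B = #|S|.
  by rewrite eqB gen (minn_idPr _) // ltnW.
have rM : \rank (col_mx u B) = (1 + #|S|)%N.
  apply/eqP; rewrite eqn_leq rank_leq_row /= -[in X in (X <= _)%N]rB.
  apply: rank_ltmx; rewrite /ltmx; apply/andP; split.
    by rewrite -(addsmxE u B) addsmxSr.
  apply: contra uS => /(submx_trans _) h; rewrite -eqB; apply: h.
  by rewrite -(addsmxE u B) addsmxSl.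
have le1S : (1 + #|S| <= n.+1)%N by [].
have [Y uY rowY] := complete_rows le1S rM.
have row0 : row ord0 Y = u.
  rewrite -[RHS](row_id ord0) -(rowKu _ u B) -rowY.
  by congr row; apply: val_inj.
exists Y, (invmx Y)^T.
pose e (x : 'I_n * 'I_r) : 'I_n.+1 :=
  if x \in S =P true is ReflectT xS then widen_ord le1S (rshift 1 (enum_rank_in xS x))
  else ord0.
have eE x (xS : x \in S) : e x = widen_ord le1S (rshift 1 (enum_rank_in xS x)).
  rewrite /e; case: eqP => // xS'; congr (widen_ord _ (rshift _ _)).
  by apply: enum_val_inj; rewrite !enum_rankK_in.
exists e; split.
- by rewrite trmxK mulVmx.
- by rewrite row0 linform_delta.
- move=> x y xS yS; rewrite (eE x xS) (eE y yS) => /(congr1 val)/eqP /=.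
  rewrite eqn_add2l => /eqP/ord_inj/(congr1 enum_val).
  by rewrite !enum_rankK_in.
move=> x xS; rewrite (eE x xS); split=> //.
by rewrite rowY rowKd rowK /entry enum_rankK_in.
Qed.

Local Notation lz := (locally_zero (complete_pseudo_grid A l) P).

(** The factors of [T j] that vanish at [P]; near [P] the other factors are units. *)
Definition in_pt_part j : {mpoly K[n.+1]} :=
  \prod_(i < r | (j, i) \in S) form (j, i).
Local Notation W := in_pt_part.

Lemma prod_hden (I : finType) (Q : pred I) (G : I -> 'rV[K]_n.+1) :
  (forall i, Q i -> ~ pt P (linform (G i))) -> hden P (\prod_(i | Q i) linform (G i)).
Proof.
move=> PG; split; last exact: prod_notin_pt.
apply: (big_ind (fun f => exists d, f \is d.-homog)).
- by exists 0%N; apply: dhomog1.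
- by move=> f g [d hf] [e hg]; exists (d + e)%N; apply: dhomogM.
- by move=> i _; exists 1%N; apply: linform_homog.
Qed.

Lemma row_product_split j : exists2 u, hden P u & T j = u * W j.
Proof.
exists (\prod_(i < r | (i < l j)%N && ((j, i) \notin S)) form (j, i)).
  apply: prod_hden => i /andP[ij nS] Pi.
  by move/negP: nS; apply; apply/pt_entriesP.
rewrite /row_product (bigID (fun i : 'I_r => (j, i) \in S)) /= mulrC.
congr (_ * _); apply: eq_bigl => i; rewrite andb_idl //.
by case/pt_entriesP.
Qed.

Lemma in_pt_part_locally_zero j k : j != k -> lz (W j * W k).
Proof.
move=> jk; have [u [[d hu] Pu] eu] := row_product_split j.
have [v [[e hv] Pv] ev] := row_product_split k; exists (u * v).
  by split; [exists (d + e)%N; apply: dhomogM|apply: pt_mul].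
have := complete_pseudo_grid_gen (A := A) l_gt0 jk.
by rewrite eu ev; congr (eqns _ _); ring.
Qed.

Lemma in_pt_part_free k : k \notin row_set S -> W k = 1.
Proof.
move=> kS; rewrite /in_pt_part big_pred0 // => i; apply: contraNF kS => iS.
by apply/imsetP; exists (k, i).
Qed.

Lemma in_pt_part1 x : x \in S -> (forall z, z \in S -> z.1 = x.1 -> z = x) ->
  W x.1 = form x.
Proof.
move=> xS xu; rewrite /in_pt_part (big_pred1 x.2) // => i /=.
apply/idP/eqP => [iS|->]; last by rewrite -surjective_pairing.
by rewrite -(xu _ iS).
Qed.

Lemma in_pt_part2 x x' : x \in S -> x' \in S -> x' != x -> x'.1 = x.1 ->
  (forall z, z \in S -> z.1 = x.1 -> z = x \/ z = x') -> W x.1 = form x * form x'.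
Proof.
move=> xS x'S xx' e xu; rewrite /in_pt_part (bigD1 x.2) /=; last first.
  by rewrite -surjective_pairing.
congr (_ * _); rewrite (big_pred1 x'.2) ?e // => i /=.
apply/idP/eqP => [/andP[iS ix]|->].
  by have [ez|<-//] := xu _ iS (erefl _); rewrite -ez eqxx in ix.
rewrite -e -surjective_pairing x'S /=; apply: contra xx' => /eqP e2.
by rewrite [x]surjective_pairing [x']surjective_pairing e e2.
Qed.

(** One vanishing entry is chosen in each row except a row [k0]; the n - 1 chosen forms cut out a
    line of the configuration through [P]. *)
Lemma entry_system : exists2 E : {set 'I_n * 'I_r}, E \subset S &
  (#|E|).+1 = n /\ (n <= #|row_set E|.+1)%N.
Proof.
have [k0 hk0] := rows_covered.
pose E := [set x in S | (x.1 != k0) && ([pick i | (x.1, i) \in S] == Some x.2)]%SET.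
have inE x : x \in E -> [/\ x \in S, x.1 != k0 & [pick i | (x.1, i) \in S] = Some x.2].
  by rewrite finset.in_set => /and3P[? ? /eqP].
have rE : row_set E = [set~ k0]%SET.
  apply/finset.setP => j; rewrite finset.in_setC finset.in_set1.
  apply/imsetP/idP => [[x /inE[_ ? _] ->] //|jk].
  have [i0 i0S] := hk0 j jk; case e: [pick i | (j, i) \in S] => [i|]; last first.
    by move: e; case: pickP => // nP _; have := nP i0; rewrite i0S.
  exists (j, i) => //; rewrite finset.in_set /= jk e eqxx andbT.
  by move: e; case: pickP => // i' i'S [<-]; rewrite i'S.
have cE : #|E| = #|row_set E|.
  apply/esym/card_in_imset => x y /inE[_ _ ex] /inE[_ _ ey] exy.
  by rewrite [x]surjective_pairing [y]surjective_pairing -exy in ey *;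
    rewrite ex in ey; case: ey => ->.
have crE : (#|row_set E|).+1 = n.
  by have := cardsC1 k0; rewrite card_ord -rE => ->; rewrite prednK // ltnW.
exists E; first by apply/fintype.subsetP => x /inE[].
by rewrite cE crE.
Qed.

Lemma pseudo_grid_local_seminormal : seminormal_ring (local_ring ZP).
Proof.
have [le_S [Y [V [e [VY Po e_inj eP]]]]] := pt_frame.
have [E ES [cardE rowsE]] := entry_system.
have rowsS : (n <= #|row_set S|.+1)%N.
  by apply: leq_trans rowsE _; rewrite ltnS row_set_mono.
(* [Sm i] holds the entries at [P] that vanish on axis [i]. If they meet at least n - 1 rows, every
   product [T j * T k] with distinct [j], [k] vanishes on the axis; [C] collects these axes. *)
pose Sm i := [set x in S | e x != i]%SET.
pose C := [set i | (i != ord0) && (n <= #|row_set (Sm i)|.+1)%N]%SET.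
have inC i : i \in C -> i != ord0 /\ (n <= #|row_set (Sm i)|.+1)%N.
  by rewrite finset.in_set => /andP[].
have SmS i : Sm i \subset S.
  by apply/fintype.subsetP => x; rewrite finset.in_set => /andP[].
have Sm_e x : x \in S -> Sm (e x) = (S :\ x)%SET.
  move=> xS; apply/finset.setP => z; rewrite finset.in_set finset.in_setD1 andbC.
  have [zS|] := boolP (z \in S); last by rewrite !andbF.
  by rewrite !andbT (inj_in_eq e_inj).
have card_out (D : {set 'I_n.+1}) : (forall i x, i \in D -> x \in S -> e x != i) ->
    (#|S| + #|D| <= n.+1)%N.
  move=> De; have := cardsC (e @: S)%SET; rewrite card_in_imset // card_ord => cS.
  suff /subset_leq_card le : D \subset ~: (e @: S)%SET.
    by apply: (leq_trans (leq_add (leqnn _) le)); rewrite cS.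
  apply/fintype.subsetP => i iD.
  rewrite finset.in_setC; apply/imsetP => -[x xS ix].
  by have := De i x iD xS; rewrite ix eqxx.
(* [Sm i] has at least n - 1 elements, and [e] maps it injectively into the n - 1 indices other than
   [ord0] and [i]; so all of these are reached. *)
have on_axes i j : i \in C -> j != ord0 -> j != i -> exists2 x, x \in S & e x = j.
  move=> /inC[i0 rows_i] j0 ji; apply: contrapT => nj.
  have ej x : x \in S -> e x != j by move=> xS; apply/eqP => exj; apply: nj; exists x.
  have e0 x : x \in S -> e x != ord0 by case/eP.
  have [[x xS exi]|ni] := pselect (exists2 x, x \in S & e x = i).
    have h2 : (#|S| + #|[set ord0; j]%SET| <= n.+1)%N.
      apply: card_out => i' x'; rewrite finset.in_set2 => /orP[]/eqP-> x'S.
        exact: e0.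
      exact: ej.
    have := row_set_leq (Sm i); rewrite -exi Sm_e // in rows_i *.
    have := cardsD1 x S; rewrite xS; move: h2 rows_i; rewrite cards2 eq_sym j0; lia.
  have h3 : (#|S| + #|(j |: [set ord0; i])%SET| <= n.+1)%N.
    apply: card_out => i' x'; rewrite finset.in_setU1 finset.in_set2.
    move=> /orP[/eqP->|/orP[]/eqP->] x'S; [exact: ej|exact: e0|].
    by apply/eqP => exi; apply: ni; exists x'.
  have := leq_trans (row_set_mono (SmS i)) (row_set_leq S).
  move: h3 rows_i; rewrite cardsU1 cards2 finset.in_set2 negb_or j0 ji eq_sym i0; lia.
(* Together with [ord0], the n - 1 entries of [E] use at most n of the n + 1 indices; on an axis
   left over, all of [E] vanishes. *)
have [i0 i0C] : exists i0, i0 \in C.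
  have [i0 i0E] : exists i0, i0 \notin (ord0 |: e @: E)%SET.
    apply: contrapT => /forallNP all_in.
    have : (#|[set: 'I_n.+1]%SET| <= #|(ord0 |: e @: E)%SET|)%N.
      by apply/subset_leq_card/fintype.subsetP => i _; apply/negPn/negP/all_in.
    rewrite cardsT card_ord cardsU1 => h.
    have := leq_trans h (leq_add (leq_b1 _) (leq_imset_card e E)).
    by rewrite add1n cardE ltnn.
  exists i0; move: i0E; rewrite finset.in_setU1 negb_or => /andP[i00 i0E].
  rewrite finset.in_set i00; apply: leq_trans rowsE _; rewrite ltnS.
  apply: row_set_mono; apply/fintype.subsetP => x xE.
  rewrite finset.in_set (fintype.subsetP ES) //=.
  by apply: contraNneq i0E => <-; apply: imset_f.
have oC : ord0 \notin C by rewrite finset.in_set eqxx.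
(* Without [x], fewer than n - 1 rows are met. Hence [x] is alone in its row and some other row has
   no entry at [P], so that the product of the two [W] is the form of [x]. *)
have off x : x \in S -> e x \notin C -> lz (form x).
  move=> xS exC; have [ex0 _] := eP x xS.
  have rx : (#|row_set (S :\ x)%SET|.+1 < n)%N.
    by move: exC; rewrite finset.in_set ex0 Sm_e //= -ltnNge.
  have xu z : z \in S -> z.1 = x.1 -> z = x.
    move=> zS zx; apply/eqP; apply: contraTT rowsS => zx'.
    by rewrite (row_setD1_same zS zx' zx) -ltnNge.
  have [k kS] : exists k, k \notin row_set S.
    apply: row_set_free; apply: leq_ltn_trans rx.
    have -> : row_set S = (x.1 |: row_set (S :\ x))%SET.
      by rewrite -[in LHS](finset.setD1K xS) /row_set imsetU imset_set1.
    by rewrite cardsU1 -add1n leq_add2r leq_b1.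
  have xk : x.1 != k by apply: contraNneq kS => <-; apply: imset_f.
  have := in_pt_part_locally_zero xk.
  by rewrite (in_pt_part_free kS) mulr1 in_pt_part1.
have meet x x' : x \in S -> x' \in S -> x != x' -> e x \in C -> e x' \in C ->
    lz (form x * form x').
  move=> xS x'S xx' /inC[_]; rewrite Sm_e // => rx /inC[_]; rewrite Sm_e // => rx'.
  (* In the same row: at most n - 2 other entries remain, so [x] and [x'] are the only ones in their
     row, and some row has no entry at [P]. *)
  have [x1|x1] := eqVneq x'.1 x.1.
    pose E2 := (S :\ x :\ x')%SET.
    have x'S1 : x' \in (S :\ x)%SET by rewrite finset.in_setD1 eq_sym xx'.
    have cE2 : (#|E2|.+2 <= n)%N.
      by move: le_S; rewrite (cardsD1 x) xS (cardsD1 x') x'S1.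
    have rS : row_set S = row_set (S :\ x)%SET.
      by apply: (row_setD1_same x'S) => //; rewrite eq_sym.
    have rS1 : row_set (S :\ x)%SET = (x'.1 |: row_set E2)%SET.
      by rewrite -[in LHS](finset.setD1K x'S1) /row_set imsetU imset_set1.
    have rE2 := row_set_leq E2.
    have nE2 : x'.1 \notin row_set E2.
      by apply/negP => xE; move: rx; rewrite rS1 cardsU1 xE; lia.
    have [k kS] : exists k, k \notin row_set S.
      by apply: row_set_free; rewrite rS rS1 cardsU1 nE2; lia.
    have xk : x.1 != k by apply: contraNneq kS => <-; apply: imset_f.
    have := in_pt_part_locally_zero xk.
    rewrite (in_pt_part_free kS) mulr1 (in_pt_part2 xS x'S) // => [|z zS zx].
      by rewrite eq_sym.
    have [->|zx0] := eqVneq z x; first by left.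
    right; apply/eqP; apply: contraNT nE2 => zx'.
    rewrite x1 -zx; apply: imset_f; rewrite !finset.in_setD1 zx' zx0.
    exact: zS.
  (* In different rows: if [z] shared the row of [y], then [S] without [y'] would meet only the rows
     met without both [y] and [y'], at most n - 2. *)
  have uniq y y' z : y \in S -> y' \in S -> y'.1 != y.1 ->
      (n <= #|row_set (S :\ y')%SET|.+1)%N -> z \in S -> z.1 = y.1 -> z = y.
    move=> yS y'S yy' ry' zS zy; apply/eqP; apply: contraTT ry' => nzy.
    have yS' : y \in (S :\ y')%SET.
      by rewrite finset.in_setD1 yS andbT; apply: contraNneq yy' => ->.
    have zS' : z \in (S :\ y')%SET.
      by rewrite finset.in_setD1 zS andbT; apply: contraNneq yy' => <-; rewrite zy.
    rewrite (row_setD1_same zS' nzy zy) -ltnNge.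
    move: le_S; rewrite (cardsD1 y') y'S (cardsD1 y) yS' => /(leq_trans _); apply.
    by rewrite !add1n !ltnS row_set_leq.
  have xx'1 : x.1 != x'.1 by rewrite eq_sym.
  have := in_pt_part_locally_zero xx'1; rewrite !in_pt_part1 // => z.
    exact: (uniq x' x z x'S xS xx'1 rx).
  exact: (uniq x x' z xS x'S x1 rx').
refine (@local_seminormal _ _ _ _ ZP Y V ord0 C i0 VY oC i0C Po _ _ _ _).
- move=> j jC j0; have ji0 : j != i0 by apply: contraNneq jC => ->.
  have [x xS ej] := on_axes i0 j i0C j0 ji0; rewrite -ej in jC *.
  by have [_ ->] := eP x xS; apply: off.
- move=> i j iC jC ij; have [j0 _] := inC j jC; have [i00 _] := inC i iC.
  have ji : j != i by rewrite eq_sym.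
  have [x xS ei] := on_axes j i jC i00 ij; have [x' x'S ej] := on_axes i j iC j0 ji.
  rewrite -ei -ej in iC jC ij *; have [_ ->] := eP x xS; have [_ ->] := eP x' x'S.
  by apply: meet => //; apply: contraNneq ij => ->.
- move=> i f iC Zf; have [i00 rows_i] := inC i iC.
  suff: complete_pseudo_grid A l `<=` [set f | restr (row ord0 V) (row i V) f = 0].
    by apply.
  apply: complete_pseudo_grid_sub => //; first exact: ker_restr_ideal.
  have row0 j : j \in row_set (Sm i) -> restr (row ord0 V) (row i V) (T j) = 0.
    case/imsetP => x; rewrite finset.in_set => /andP[xS exi] ->.
    have [xl _] := (pt_entriesP x).1 xS; have [ex0 ex] := eP x xS.
    rewrite /row_product (bigD1 x.2) //= rmorphM /= -ex restr_coord //.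
    by rewrite (negbTE ex0) (negbTE exi) scale0r addr0 mul0r.
  move=> j k jk /=; rewrite rmorphM /=.
  by have [/row0->|/row0->] := row_set_two rows_i jk; rewrite ?mul0r ?mulr0.
- move=> i j iC j0 ji; have [x xS <-] := on_axes i j iC j0 ji.
  by have [_ ->] := eP x xS; case/pt_entriesP: xS.
Qed.

End PseudoGridPoint.

(** * The lines of a pseudo-grid *)

Section PseudoGrid.
Variables (K : fieldType) (n r : nat) (A : 'I_n -> 'I_r -> 'rV[K]_n.+1).
Variable l : 'I_n -> nat.
Hypothesis n_ge2 : (2 <= n)%N.
Hypothesis l_gt0 : forall j, (0 < l j)%N.
Hypothesis gen : generic_entries A.
Local Notation Z := (complete_pseudo_grid A l).

Lemma pseudo_grid_seminormal : seminormal Z.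
Proof. by move=> P ZP; apply: pseudo_grid_local_seminormal. Qed.

(** The lines come from the choices of n - 1 entries, within the bounds [l], in n - 1 different
    rows: on such a line at most one [T j] does not vanish, and by [entry_system] every point of the
    scheme lies on one. *)
Lemma pseudo_grid_line_configuration : line_configuration Z.
Proof.
split=> [P ZP|]; first by have [] := pseudo_grid_seminormal ZP.
pose good (E : {set 'I_n * 'I_r}) :=
  [&& (#|E|).+1 == n, (n <= #|row_set E|.+1)%N & [forall x in E, (x.2 < l x.1)%N]].
have line E : exists pq : 'rV[K]_n.+1 * 'rV[K]_n.+1, good E ->
    \rank (col_mx pq.1 pq.2) = 2%N /\ forall c,
    (dotp c pq.1 = 0 /\ dotp c pq.2 = 0) <-> (c <= \sum_(x in E) <<A x.1 x.2>>)%MS.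
  have [/and3P[/eqP cE _ _]|] := boolP (good E); last by exists (0, 0).
  have rE : (\rank (\sum_(x in E) <<A x.1 x.2>>)%MS).+1 = n.
    by rewrite gen (minn_idPr _) // -ltnS cE ltnW.
  by have [pq hpq] := line_of_forms rE; exists pq.
have [pq hpq] := choice line.
exists [seq pq E | E <- enum good]; split=> [_ /mapP[E + ->]|P].
  by rewrite mem_enum => /hpq[].
have PI : is_ideal P := proj1 (ptP P).
split=> [ZP|[_ /mapP[E + ->]]].
  have [E ES [cE rE]] := entry_system n_ge2 l_gt0 ZP.
  have gE : good E.
    rewrite /good cE eqxx rE /=; apply/forall_inP => x xE.
    by have /pt_entriesP[] := fintype.subsetP ES x xE.
  exists (pq E); first by apply: map_f; rewrite mem_enum.
  apply: smallest_sub => // _ [c [-> /vanishes_atE cp /vanishes_atE cq]].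
  have [_ hE] := hpq E gE; have /hE := conj cp cq.
  apply: linform_sub_ideal => // x xE.
  by have /pt_entriesP[] := fintype.subsetP ES x xE.
rewrite mem_enum => gE EP; have [_ hE] := hpq E gE.
have /and3P[_ rE /forall_inP lE] := gE.
have row_in j : j \in row_set E -> pt P (row_product A l j).
  case/imsetP => x xE ->; rewrite /row_product (bigD1 x.2) /=; last exact: lE.
  rewrite mulrC; apply: (idealM PI); apply: EP; apply: smallest_gen => /=.
  have [vp vq] : dotp (A x.1 x.2) (pq E).1 = 0 /\ dotp (A x.1 x.2) (pq E).2 = 0.
    by apply/hE/(sumsmx_sup x) => //; rewrite genmxE.
  by exists (A x.1 x.2); split=> //; apply/vanishes_atE.
apply: complete_pseudo_grid_sub => // j k jk.
have [jE|kE] := row_set_two rE jk; last by apply: (idealM PI); apply: row_in.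
by rewrite mulrC; apply: (idealM PI); apply: row_in.
Qed.

End PseudoGrid.

(** * Complete grids *)

Section LineIdeal.
Variables (K : fieldType) (n : nat).
Implicit Types (p q : 'rV[K]_n.+1).

Lemma line_ideal_mono p q p' q' :
  (forall c, dotp c p = 0 -> dotp c q = 0 -> dotp c p' = 0 /\ dotp c q' = 0) ->
  line_ideal p q `<=` line_ideal p' q'.
Proof.
move=> hc; apply: smallest_sub; first exact: smallest_ideal.
move=> _ [c [-> /vanishes_atE cp /vanishes_atE cq]]; apply: smallest_gen => /=.
by have [? ?] := hc c cp cq; exists c; split=> //; apply/vanishes_atE.
Qed.

(** Completing [p], [q] to a frame turns the line into a single coordinate axis. *)
Lemma line_nullstellensatz p q d f : \rank (col_mx p q) = 2%N ->
  f \is d.-homog -> restr p q f = 0 -> line_ideal p q f.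
Proof.
move=> rk hf f0; have n2 : (1 + 1 <= n.+1)%N.
  by rewrite (leq_trans _ (rank_leq_col (col_mx p q))) // rk.
have [V uV rowV] := complete_rows n2 rk.
pose o := widen_ord n2 (lshift 1 ord0); pose i := widen_ord n2 (rshift 1 ord0).
have Vo : row o V = p by rewrite rowV rowKu row_id.
have Vi : row i V = q by rewrite rowV rowKd row_id.
have VY : V^T *m (invmx V)^T = 1%:M by rewrite -trmx_mul mulVmx // trmx1.
have oi : o \notin [set i]%SET by rewrite finset.in_set1.
have := axes_nullstellensatz VY oi (set11 i) hf.
have h j : j \in [set i]%SET -> restr (row o V) (row j V) f = 0.
  by rewrite finset.in_set1 => /eqP->; rewrite Vo Vi.
move/(_ h); suff : axes_ideal (invmx V)^T o [set i]%SET `<=` line_ideal p q by apply.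
apply: smallest_sub; first exact: smallest_ideal.
move=> g [[j [ji jo ->]]|[j [j' [ji j'i jj' _]]]].
  apply: smallest_gen => /=; exists (row j (invmx V)^T).
  rewrite finset.in_set1 in ji; split=> //; apply/vanishes_atE.
    by rewrite -Vo dotp_dual // (negbTE jo).
  by rewrite -Vi dotp_dual // (negbTE ji).
move: ji j'i jj'; rewrite !finset.in_set1 => /eqP-> /eqP->.
by rewrite eqxx.
Qed.

Lemma restr0_homog q d f : f \is d.-homog ->
  restr 0 q f = f.@[fun a => q 0 a] *: 'X^d.
Proof.
move: d f; apply: homog_ind.
- by rewrite rmorph1 meval1 expr0 scale1r.
- by move=> d; rewrite rmorph0 meval0 scale0r.
- by move=> d f g hf hg; rewrite rmorphD /= hf hg mevalD scalerDl.
- by move=> d c f hf; rewrite restrZ hf mevalZ scalerA.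
move=> d i f hf; rewrite rmorphM /= hf restrX mevalM mevalXU mxE polyC0 add0r.
by rewrite -scalerAl -scalerAr -exprS scalerA.
Qed.

(** The homogeneous components of [f] give the coefficients of f(t q). *)
Lemma restr0_pihomog q d f :
  restr 0 q (pihomog mdeg d f) = (restr 0 q f)`_d *: 'X^d.
Proof.
rewrite [f]mpolyE (raddf_sum (pihomog mdeg d)) !(raddf_sum (restr 0 q)) /=.
rewrite coef_sum scaler_suml; apply: eq_bigr => m _.
rewrite linearZ /= !restrZ coefZ -scalerA; congr (_ *: _).
have hm : ('X_[m] : {mpoly K[n.+1]}) \is (mdeg m).-homog by rewrite dhomogX; apply/eqP.
rewrite pihomogX (restr0_homog q hm) coefZ coefXn (eq_sym d).
case: eqP => [<-|_]; first by rewrite (restr0_homog q hm) mulr1.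
by rewrite rmorph0 mulr0 scale0r.
Qed.

Lemma restr_at_zero q d f : f \is d.-homog ->
  restr 0 q f = 0 <-> f.@[fun a => q 0 a] = 0.
Proof.
move=> hf; rewrite (restr0_homog q hf); split=> [/eqP|->]; last by rewrite scale0r.
by rewrite scaler_eq0 expf_eq0 polyX_eq0 andbF orbF => /eqP.
Qed.

Section PointOf.
Variables (q : 'rV[K]_n.+1) (i : 'I_n.+1).
Hypothesis qi : q 0 i != 0.

Lemma point_homogeneous : homogeneous_ideal [set f | restr 0 q f = 0].
Proof.
split=> [|f d /= f0]; first exact: ker_restr_ideal.
by rewrite restr0_pihomog f0 coef0 scale0r.
Qed.

Lemma point_prime f g : restr 0 q (f * g) = 0 -> restr 0 q f = 0 \/ restr 0 q g = 0.
Proof. by rewrite rmorphM => /eqP; rewrite mulf_eq0 => /orP[] /eqP; [left|right]. Qed.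

Lemma point_relevant : exists i, ~ restr 0 q 'X_i = 0.
Proof.
exists i; rewrite restrX mxE polyC0 add0r => /eqP.
by rewrite scaler_eq0 polyX_eq0 orbF (negbTE qi).
Qed.

(** The condition is f(t q) = 0 in K[t] instead of f(q) = 0: the two agree on forms, and the first
    defines a homogeneous ideal. *)
Definition rational_point : proj_point K n :=
  ProjPoint point_homogeneous point_prime point_relevant.

End PointOf.

End LineIdeal.

Lemma homog1_linform (K : fieldType) (n : nat) (h : {mpoly K[n.+1]}) :
  h \is 1.-homog -> exists c, h = linform c.
Proof.
suff H d f : f \is d.-homog -> (d = 0%N -> exists c : K, f = c%:MP) /\
    (d = 1%N -> exists c : 'rV[K]_n.+1, f = linform c).
  by move=> /H[_]; apply.
move: d f; apply: homog_ind.
- by split=> // _; exists 1.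
- move=> d; split=> _; first by exists 0; rewrite mpolyC0.
  by exists 0; rewrite /linform big1 // => a _; rewrite mxE scale0r.
- move=> d f g [f0 f1] [g0 g1]; split=> e.
    have [c ->] := f0 e; have [c' ->] := g0 e.
    by exists (c + c'); rewrite mpolyCD.
  have [c ->] := f1 e; have [c' ->] := g1 e.
  by exists (c + c'); rewrite linformD.
- move=> d a f [f0 f1]; split=> e.
    have [c ->] := f0 e; exists (a * c).
    by rewrite -mul_mpolyC mpolyCM.
  by have [c ->] := f1 e; exists (a *: c); rewrite linformZ.
move=> d i f [f0 _]; split=> // -[e]; have [c ->] := f0 e.
by exists (c *: delta_mx 0 i); rewrite linformZ linform_delta mulrC mul_mpolyC.
Qed.

(** * Coefficients of forms along lines through a point *)

Section Cone.
Variables (K : fieldType) (n : nat) (k : 'I_n) (T : finType).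
Variable v : T -> 'rV[K]_n.+1.
Local Notation R := {mpoly K[n.+1]}.
Local Notation kk := (lift ord0 k).
Local Notation e := (pinf K k).
Local Notation rho a := (restr e (v a)).
(** The [v a] are directions of lines through [e], normalized to have 0-th coordinate 1 and no
    component along [e]. *)
Hypothesis v0 : forall a, v a 0 ord0 = 1.
Hypothesis vk : forall a, v a 0 kk = 0.
Hypothesis v_inj : injective v.

Lemma pinfE i : e 0 i = (i == kk)%:R.
Proof. by rewrite mxE eqxx. Qed.

(* The families of coefficients [phi] such that [(phi a * t^d)] on the lines
   [t |-> e + t * v a] is cut out by a form of degree [d]. *)
Definition attained d (phi : T -> K) : Prop :=
  exists2 h, h \is d.-homog & forall a, rho a h = phi a *: 'X^d.

Lemma attained_ext d phi psi : phi =1 psi -> attained d phi -> attained d psi.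
Proof. by move=> e1 [h hh hr]; exists h => // a; rewrite hr e1. Qed.

Lemma attained1 : attained 0 (fun=> 1).
Proof. by exists 1; [exact: dhomog1|move=> a; rewrite rmorph1 expr0 scale1r]. Qed.

Lemma attained0 d : attained d (fun=> 0).
Proof. by exists 0; [exact: rpred0|move=> a; rewrite rmorph0 scale0r]. Qed.

Lemma attainedD d phi psi :
  attained d phi -> attained d psi -> attained d (fun a => phi a + psi a).
Proof.
move=> [f hf ef] [g hg eg]; exists (f + g); first exact: rpredD.
by move=> a; rewrite rmorphD /= ef eg scalerDl.
Qed.

Lemma attainedZ d c phi : attained d phi -> attained d (fun a => c * phi a).
Proof.
move=> [f hf ef]; exists (c *: f); first exact: rpredZ.
by move=> a; rewrite restrZ ef scalerA.
Qed.

Lemma attained_mul_coord d i phi :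
  attained d phi -> attained d.+1 (fun a => v a 0 i * phi a).
Proof.
move=> [f hf ef]; have [->|ik] := eqVneq i kk.
  by apply: attained_ext (attained0 d.+1) => a; rewrite vk mul0r.
exists ('X_i * f).
  have hX : ('X_i : R) \is 1.-homog by rewrite dhomogX; apply/eqP/mdeg1.
  by have := dhomogM hX hf; rewrite add1n.
move=> a; rewrite rmorphM /= ef restrX pinfE (negbTE ik) add0r.
by rewrite -scalerAl -scalerAr -exprS scalerA.
Qed.

Lemma attainedS d phi : attained d phi -> attained d.+1 phi.
Proof.
move=> /(attained_mul_coord ord0); apply: attained_ext => a.
by rewrite v0 mul1r.
Qed.

(** Each variable restricts to a polynomial of degree at most 1 in t, so multiplying by it combines
    coefficients of the same and the preceding degree. *)
Lemma attained_coef m g d : g \is m.-homog -> attained d (fun a => (rho a g)`_d).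
Proof.
move=> hg; move: m g hg d.
apply: (homog_ind (Q := fun _ g => forall d, attained d (fun a => (rho a g)`_d))).
- case=> [|d].
    by apply: attained_ext attained1 => a; rewrite rmorph1 coef1.
  by apply: attained_ext (attained0 _) => a; rewrite rmorph1 coef1.
- by move=> _ d; apply: attained_ext (attained0 _) => a; rewrite rmorph0 coef0.
- move=> _ f g hf hg d; apply: attained_ext (attainedD (hf d) (hg d)) => a.
  by rewrite rmorphD coefD.
- move=> _ c f hf d; apply: attained_ext (attainedZ c (hf d)) => a.
  by rewrite restrZ coefZ.
move=> _ i f hf [|d].
  apply: attained_ext (attainedZ (e 0 i) (hf 0%N)) => a.
  rewrite rmorphM /= restrX mulrDl -scalerAl coefD coefZ mul_polyC coefZ coefXM.
  by rewrite mulr0 addr0.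
apply: attained_ext (attainedD (attainedZ (e 0 i) (hf d.+1))
                               (attained_mul_coord i (hf d))) => a.
by rewrite rmorphM /= restrX mulrDl -scalerAl coefD coefZ mul_polyC coefZ coefXM.
Qed.

(** Interpolation: products of #|T| - 1 linear forms separate one [v a] from all others, and the
    resulting delta families span everything. *)
Lemma attained_all phi : attained #|T| phi.
Proof.
have sep a (s : seq T) : a \notin s -> exists2 psi, attained (size s) psi &
    psi a = 1 /\ forall b, b \in s -> psi b = 0.
  elim: s => [|b s IH]; first by exists (fun=> 1); [exact: attained1|].
  rewrite in_cons negb_or => /andP[ab /IH[psi Wpsi [psia psis]]].
  have [i vi] : exists i, v a 0 i - v b 0 i != 0.
    apply: contrapT => /forallNP same; move/eqP: ab; apply; apply/v_inj/rowP => i.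
    by apply/eqP; rewrite -subr_eq0; apply/negPn/negP/same.
  (* The new factor ['X_i - v b 0 i *: 'X_ord0] vanishes at [v b] and is scaled to be 1 at [v a]. *)
  exists (fun c => (v a 0 i - v b 0 i)^-1 * (v c 0 i * psi c + - v b 0 i * psi c)).
    apply: attainedZ; apply: attainedD; first exact: attained_mul_coord.
    exact/attainedS/attainedZ.
  split=> [|c]; first by rewrite psia !mulr1 mulVf.
  rewrite in_cons => /orP[/eqP->|/psis->]; last by rewrite !mulr0 addr0 mulr0.
  by rewrite mulNr subrr mulr0.
have delta a : attained #|T| (fun b => (b == a)%:R).
  have [|psi Wpsi [psia psi0]] := sep a (enum (predC1 a)).
    by rewrite mem_enum /= negbK /= eqxx.
  have -> : #|T| = (size (enum (predC1 a))).+1.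
    by rewrite -cardE cardC1 prednK // (cardD1 a).
  apply: attained_ext (attainedS Wpsi) => b; have [->//|ba] := eqVneq b a.
  by rewrite psi0 // mem_enum.
have W (s : seq T) : attained #|T| (fun b => \sum_(a <- s) phi a * (b == a)%:R).
  elim: s => [|a s IH].
    by apply: attained_ext (attained0 _) => b; rewrite big_nil.
  apply: attained_ext (attainedD (attainedZ (phi a) (delta a)) IH) => b.
  by rewrite big_cons.
apply: attained_ext (W (index_enum T)) => b.
rewrite (bigD1 b) //= eqxx mulr1 big1 ?addr0 // => a ab.
by rewrite eq_sym (negbTE ab) mulr0.
Qed.

(* The [k]-th coordinates of the [v a] vanish, so the [v a] span a space of
   dimension at most [n]. *)
Lemma attained1_dim : (forall phi, attained 1 phi) -> (#|T| <= n)%N.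
Proof.
move=> all1.
have lin phi : exists c : 'rV[K]_n.+1, forall a, dotp c (v a) = phi a.
  have [h hh hr] := all1 phi; have [c hc] := homog1_linform hh.
  exists c => a; have /(congr1 (coefp 1)) := hr a.
  by rewrite hc restr_linform /= coefD coefC !coefZ !coefX !mulr1 add0r.
(* The forms [c a] are dual to the [v a]. Since coordinate [kk] of every [v a] is 0, the identity of
   size #|T| factors through dimension [n]. *)
have [c hc] := choice (fun a : T => lin (fun b => (b == a)%:R)).
pose N := #|T|.
pose M1 : 'M[K]_(N, n) := \matrix_(a, i) v (enum_val a) 0 (lift kk i).
pose M2 : 'M[K]_(n, N) := \matrix_(i, a) c (enum_val a) 0 (lift kk i).
have e1 : M1 *m M2 = 1%:M.
  apply/matrixP => a b; rewrite !mxE -(inj_eq enum_val_inj) -hc /dotp.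
  rewrite (bigD1_ord kk) //= vk mulr0 add0r; apply: eq_bigr => i _.
  by rewrite !mxE mulrC.
rewrite -/N -(mxrank1 K N) -e1.
exact: leq_trans (mxrankM_maxr _ _) (rank_leq_row _).
Qed.

(** Degree 1 fails by dimension, and nothing fails from degree #|T| on, so there is a largest
    failing degree. *)
Lemma exists_gap : (n < #|T|)%N -> exists d phi,
  [/\ (0 < d)%N, ~ attained d phi & forall d' psi, (d < d')%N -> attained d' psi].
Proof.
move=> nT; pose Q d := `[< exists phi, ~ attained d phi >].
have Q1 : Q 1%N.
  apply/asboolP; apply: contrapT => /forallNP all1.
  move: nT; rewrite ltnNge attained1_dim // => phi; apply: contrapT; exact: all1.
have up d phi : (#|T| <= d)%N -> attained d phi.
  move=> /subnK <-; elim: (d - _)%N => [|i IH]; rewrite ?add0n ?addSn.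
    exact: attained_all.
  exact: attainedS.
have bd d : Q d -> (d <= #|T|)%N.
  move=> /asboolP[phi nW]; rewrite leqNgt; apply/negP => /ltnW le; apply: nW; exact: up.
have exQ : exists d, Q d by exists 1%N.
case: (ex_maxnP exQ bd) => d /asboolP[phi nW] dmax; exists d, phi; split=> //.
  exact: dmax.
move=> d' psi dd'; apply: contrapT => nW'.
have /dmax : Q d' by apply/asboolP; exists psi.
by rewrite leqNgt dd'.
Qed.

End Cone.

(** * The local ring of a grid at a point at infinity *)

Section GridVertex.
Variables (K : fieldType) (n : nat) (A : 'I_n -> {fset K}) (k : 'I_n) (T : finType).
Variable v : T -> 'rV[K]_n.+1.
Local Notation R := {mpoly K[n.+1]}.
Local Notation kk := (lift ord0 k).
Local Notation e := (pinf K k).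
Local Notation rho a := (restr e (v a)).
Hypothesis v0 : forall a, v a 0 ord0 = 1.
Hypothesis vk : forall a, v a 0 kk = 0.
Hypothesis v_inj : injective v.
(** [T] indexes the projections of the grid basis from [e], that is, the grid lines through [e]. *)
Hypothesis basis_proj : forall x, grid_basis A x -> exists a, x = v a + x 0 kk *: e.
Hypothesis basis_lift : forall a, exists2 x, grid_basis A x & x = v a + x 0 kk *: e.
Hypothesis T_gt : (n < #|T|)%N.
Local Notation Z := (complete_grid A).

Lemma pinf_neq0 : e 0 kk != 0.
Proof. by rewrite pinfE eqxx oner_eq0. Qed.

Local Notation P := (rational_point pinf_neq0).

Lemma grid_eqns_restr f a : eqns Z f -> rho a f = 0.
Proof.
have [x gx ex] := basis_lift a; move/(_ x k gx).
apply: line_ideal_restr => c cx ce; split=> //.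
have -> : v a = x + (- x 0 kk) *: e by rewrite {1}ex scaleNr addrK.
by rewrite dotpDr dotpZr cx ce mulr0 addr0.
Qed.

Lemma grid_vertex : Z `<=` P.
Proof.
move=> f Zf; have /card_gt0P[a _] : (0 < #|T|)%N by apply: leq_trans T_gt.
have [x gx _] := basis_lift a; move: (Zf x k gx).
apply: line_ideal_restr => c _ ->; split=> //.
by rewrite /dotp big1 // => i _; rewrite mxE mulr0.
Qed.

Local Notation F := (local_fracData grid_vertex).
Local Notation B := (local_ring grid_vertex).

Lemma vertex_restr0 h d a : h \is d.-homog -> ~ pt P h ->
  (rho a h).[0] != 0 /\ (rho a h).[0] = h.@[fun i => e 0 i].
Proof.
move=> hh Ph; rewrite restr_at0; split=> //.
by apply/eqP => h0; apply: Ph; apply/(restr_at_zero _ hh).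
Qed.

(** Along a grid line in another direction the [k]-th affine coordinate is constant; the hyperplane
    so defined does not contain the vertex. *)
Lemma X_in_line x k' : grid_basis A x -> k' != k ->
  line_ideal x (pinf K k') ('X_kk - x 0 kk *: 'X_ord0).
Proof.
move=> [x0 _] kk'; pose c : 'rV[K]_n.+1 := delta_mx 0 kk + (- x 0 kk) *: delta_mx 0 ord0.
have -> : 'X_kk - x 0 kk *: 'X_ord0 = linform c.
  by rewrite linformD linformZ !linform_delta scaleNr.
have dot p : dotp c p = p 0 kk - x 0 kk * p 0 ord0.
  by rewrite dotpDl dotpZl !dotp_delta mulNr.
apply: smallest_gen => /=; exists c; split=> //.
- by apply/vanishes_atE; rewrite dot x0 mulr1 subrr.
- apply/vanishes_atE; rewrite dot !pinfE (inj_eq lift_inj) eq_sym (negbTE kk').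
  by rewrite mulr0 subr0.
Qed.

Lemma rank_line a : \rank (col_mx e (v a)) = 2%N.
Proof.
apply/eqP; rewrite eqn_leq rank_leq_row.
pose N : 'M[K]_(n.+1, 1 + 1) := row_mx e^T (delta_mx 0 ord0)^T.
have MN : col_mx e (v a) *m N = 1%:M.
  have dot p q : p *m q^T = (dotp p q)%:M :> 'M_1.
    by rewrite dotpE -mx11_scalar.
  have dote p : dotp e p = p 0 kk by exact: dotp_delta.
  have dot0 p : dotp p (delta_mx 0 ord0) = p 0 ord0.
    by rewrite -dotp_delta; apply: eq_bigr => i _; rewrite mulrC.
  have dotv : dotp (v a) e = 0.
    by rewrite -(vk a) -dote; apply: eq_bigr => i _; rewrite mulrC.
  rewrite mul_col_row !dot dote dotv !dot0 v0 !pinfE eqxx.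
  by rewrite (_ : ord0 == kk = false) // !raddf0 -scalar_mx_block.
by rewrite -[2%N](mxrank1 K (1 + 1)) -MN mxrankM_maxl.
Qed.

Lemma grid_locally_zero d f : f \is d.-homog ->
  (exists2 u, hden P u & eqns Z (u * f)) <-> forall a, rho a f = 0.
Proof.
move=> hf; split=> [[u [[du hu] Pu] Zuf] a|f0].
  have /eqP := grid_eqns_restr a Zuf; rewrite rmorphM mulf_eq0 => /orP[/eqP u0|/eqP//].
  by have [] := vertex_restr0 a hu Pu; rewrite u0 horner0 eqxx.
(* [u] is invertible at the vertex and vanishes on all grid lines in directions other than [k]. *)
pose u : R := \prod_(b <- A k) ('X_kk - b *: 'X_ord0).
have hX i : ('X_i : R) \is 1.-homog by rewrite dhomogX; apply/eqP/mdeg1.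
exists u.
  have homog_factor b : ('X_kk - b *: 'X_ord0 : R) \is 1.-homog.
    by apply: rpredB; [exact: hX|apply: rpredZ; exact: hX].
  split=> [|/=].
    rewrite /u; elim: (enum_fset (A k)) => [|b s [d' IH]].
      by exists 0%N; rewrite big_nil; apply: dhomog1.
    by exists (1 + d')%N; rewrite big_cons; apply: dhomogM.
  rewrite /u; elim: (enum_fset (A k)) => [|b s IH].
    by rewrite big_nil; apply: (@pt_proper _ _ P).
  rewrite big_cons; apply: (@pt_mul _ _ P) => //= /(restr_at_zero _ (homog_factor b)).
  rewrite mevalB mevalZ !mevalXU !pinfE eqxx (_ : ord0 == kk = false) //.
  by rewrite mulr0 subr0 => /eqP; rewrite oner_eq0.
move=> x k' gx; have [idL _] := line_ideal_homogeneous x (pinf K k').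
have [->|kk'] := eqVneq k' k.
  have [a ex] := basis_proj gx; apply: (idealM (line_ideal_homogeneous x e).1).
  apply: (@line_ideal_mono _ _ e (v a)).
    move=> c ce cv; split=> //.
    by rewrite ex dotpDr dotpZr ce cv mulr0 addr0.
  exact: line_nullstellensatz (rank_line a) hf (f0 a).
rewrite /u (big_rem (x 0 kk)) /=; last by case: gx => _ /(_ k).
rewrite -mulrA mulrC; apply: (idealM idL); exact: X_in_line.
Qed.

Lemma grid_mk_eqP (a b : R * R) (ha : fd_frac F a) (hb : fd_frac F b) :
  mk_frac ha = mk_frac hb <->
  forall c, rho c a.1 * rho c b.2 = rho c b.1 * rho c a.2.
Proof.
have [[d [ha1 ha2]] _] := ha; have [[d' [hb1 hb2]] _] := hb.
rewrite mk_frac_eqP.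
have hom : a.1 * b.2 - b.1 * a.2 \is (d + d').-homog.
  by apply: rpredB; [|rewrite addnC]; apply: dhomogM.
split=> [|e0]; first move/(grid_locally_zero hom) => e0 c.
  by have /eqP := e0 c; rewrite rmorphB !rmorphM subr_eq0 => /eqP.
apply/(grid_locally_zero hom) => c.
by rewrite rmorphB !rmorphM e0 ?subrr.
Qed.

(** The witness is [phi a] t^d on line [a], with [d] the largest failing degree and [phi] not
    attained there: its higher powers have larger degree, where every family is attained. *)
Lemma grid_vertex_not_seminormal : ~ seminormal_ring B.
Proof.
move=> [_ sn]; have [d [phi [d_gt0 nphi up]]] := exists_gap v0 vk v_inj T_gt.
have hX i : ('X_i : R) \is 1.-homog by rewrite dhomogX; apply/eqP/mdeg1.
have rX0 a : rho a 'X_ord0 = 'X.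
  by rewrite restrX pinfE v0 scale1r add0r.
have rXk a : rho a 'X_kk = 1.
  by rewrite restrX pinfE vk eqxx scale0r addr0.
have Pk m : ~ pt P ('X_kk ^+ m).
  have hm := dhomogMn m (hX kk); move/(restr_at_zero _ hm).
  by rewrite rmorphXn /= mevalXU pinfE eqxx expr1n => /eqP; rewrite oner_eq0.
(* In degree [d.+1] the family is attained; dividing by the nonzerodivisor ['X_ord0 / 'X_kk], which
   restricts to t, gives [q]. *)
have [f hf rf] := up d.+1 phi (ltnSn d).
have hF : fd_frac F (f, 'X_kk ^+ d.+1).
  split; last exact: Pk.
  by exists d.+1; split=> //; rewrite -[X in X.-homog]mul1n; apply: dhomogMn.
have hS : fd_frac F ('X_ord0, 'X_kk ^+ 1).
  by split; [exists 1%N; split=> /=; rewrite ?expr1; exact: hX|exact: Pk].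
have nzS : nonzerodivisor (mk_frac hS).
  move=> x; have [[g h] [hg ->]] := fracW x; have [[dg [/= hg1 _]] _] := hg.
  rewrite mk_fracM => /mk_frac0P/(grid_locally_zero (dhomogM (hX ord0) hg1)) g0.
  apply/mk_frac0P/(grid_locally_zero hg1) => a; have /eqP := g0 a.
  by rewrite rmorphM /= rX0 mulf_eq0 polyX_eq0 => /eqP.
pose q := @mk_frac B (total_fracData B) (mk_frac hF, mk_frac hS) nzS.
have q_pow m : (1 < m)%N -> range (@to_total_frac B) (q ^+ m).
  move=> m_gt1; have [|g hg rg] := up (d * m)%N (fun a => phi a ^+ m).
    by rewrite ltn_Pmulr.
  have hG : fd_frac F (g, 'X_kk ^+ (d * m)).
    split; last exact: Pk.
    by exists (d * m)%N; split=> //; rewrite -[X in X.-homog]mul1n; apply: dhomogMn.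
  exists (mk_frac hG) => //; apply/esym/total_frac_expP.
  have [hF' ->] := mk_fracX hF m; have [hS' ->] := mk_fracX hS m.
  rewrite mk_fracM; apply/grid_mk_eqP => a /=.
  rewrite !(rmorphM, rmorphXn) /= ?rmorphXn /= rXk !expr1n !mulr1 rf rg rX0.
  by rewrite exprZn -!exprM -scalerAl -exprD mulSnr.
have [] : range (@to_total_frac B) q.
  apply: sn; [apply: integralOver_square| |]; exact: q_pow.
move=> b _ /esym/total_frac_eqP; have [[g h] [hb ->]] := fracW b.
have [[db [/= hg hh]] /= Ph] := hb.
rewrite mk_fracM => /grid_mk_eqP /= E; apply: nphi.
have rgh a : phi a *: 'X^d * rho a h = rho a g.
  have := E a; rewrite !(rmorphM, rmorphXn) /= rXk !expr1n !mulr1 rf rX0 => Ea.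
  apply: (mulIf (negbT (polyX_eq0 K))); rewrite -Ea exprSr scalerAl; ring.
(* If [q] were g/h, the coefficient of t^d in [g] on line [a] would be [phi a] times h(e); dividing
   by the constant h(e) would make [phi] attained. *)
have := attainedZ (h.@[fun i => e 0 i])^-1 (attained_coef vk d hg).
apply: attained_ext => a /=; have [h0 <-] := vertex_restr0 a hh Ph.
rewrite -rgh -scalerAl coefZ coefXnM ltnn subnn -horner_coef0.
by rewrite mulrCA mulVf ?mulr1.
Qed.

End GridVertex.

Lemma complete_grid_not_seminormal (K : fieldType) (n : nat)
    (A : 'I_n -> {fset K}) (l : 'I_n -> nat) :
  (forall j, (0 < l j)%N) -> (forall j, #|` A j| = l j) ->
  (exists k : 'I_n, (n < \prod_(j < n | j != k) l j)%N) ->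
  ~ seminormal (complete_grid A).
Proof.
move=> l_gt0 cA [k big_k] sn.
(* With {0} in place of [A k], each line through [pinf k] is represented by its point with [k]-th
   coordinate 0, and [T] has as many elements as there are such lines. *)
pose A' j : {fset K} := if j == k then [fset 0]%fset else A j.
have A'k : A' k = [fset 0]%fset by rewrite /A' eqxx.
have A'j j : j != k -> A' j = A j by rewrite /A' => /negbTE->.
pose T := {dffun forall j : 'I_n, A' j}.
pose v (a : T) : 'rV[K]_n.+1 :=
  \row_i (if unlift ord0 i is Some j then val (a j) else 1).
have v0 a : v a 0 ord0 = 1 by rewrite mxE unlift_none.
have vj a j : v a 0 (lift ord0 j) = val (a j) by rewrite mxE liftK.
have vk a : v a 0 (lift ord0 k) = 0.
  have : v a 0 (lift ord0 k) \in A' k by rewrite vj; exact: valP.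
  by rewrite A'k finmap.in_fset1 => /eqP.
have v_inj : injective v.
  by move=> a b eab; apply/ffunP => j; apply: val_inj; rewrite -!vj eab.
have cT : #|T| = \prod_(j < n | j != k) l j.
  rewrite card_dep_ffun foldrE big_map big_enum /= (bigD1 k) //=.
  rewrite -cardfE A'k cardfs1 mul1n; apply: eq_bigr => j jk.
  by rewrite -cardfE A'j // cA.
have proj x : grid_basis A x -> exists a, x = v a + x 0 (lift ord0 k) *: pinf K k.
  move=> [x0 xA]; have xA' j : (if j == k then 0 else x 0 (lift ord0 j)) \in A' j.
    by rewrite /A'; case: eqP => _; [rewrite finmap.in_fset1|exact: xA].
  exists [ffun j => [` xA' j]%fset]; apply/rowP => i.
  rewrite mxE [in X in _ + X]mxE pinfE; have [j ->|->] := unliftP ord0 i; last first.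
    by rewrite v0 (_ : ord0 == lift _ _ = false) // mulr0 addr0.
  rewrite vj ffunE /= (inj_eq lift_inj); have [->|jk] := eqVneq j k.
    by rewrite add0r mulr1.
  by rewrite mulr0 addr0.
have lift_v a : exists2 x, grid_basis A x & x = v a + x 0 (lift ord0 k) *: pinf K k.
  have [b bA] : exists b, b \in A k.
    by apply/fset0Pn; rewrite -cardfs_gt0 cA.
  have xe i : (v a + b *: pinf K k) 0 i = v a 0 i + b * (i == lift ord0 k)%:R.
    by rewrite mxE [in X in _ + X]mxE pinfE.
  exists (v a + b *: pinf K k); last by rewrite xe vk add0r eqxx mulr1.
  split=> [|j]; first by rewrite xe v0 mulr0 addr0.
  rewrite xe (inj_eq lift_inj); have [->|jk] := eqVneq j k.
    by rewrite vk add0r mulr1.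
  by rewrite mulr0 addr0 -(A'j j jk) vj; exact: valP.
have T_gt : (n < #|T|)%N by rewrite cT.
apply: (grid_vertex_not_seminormal v0 vk v_inj proj).
exact: (sn _ (grid_vertex (k := k) lift_v T_gt)).
Qed.

Theorem proposition7p4 (K : fieldType) (n : nat)
    (hK : infinite_set [set: K]) (hn : (2 <= n)%N) :
  (forall (l : 'I_n -> nat) (A : 'I_n -> {fset K}),
     (forall j, (1 <= l j)%N) ->
     (forall j, #|` A j| = l j) ->
     (exists k : 'I_n, (n < \prod_(j < n | j != k) l j)%N) ->
     ~ seminormal (complete_grid A))
  /\
  (forall (l : 'I_n -> nat) (r : nat) (A : 'I_n -> 'I_r -> 'rV[K]_n.+1),
     (forall j, (1 <= l j)%N) ->
     (forall j, (l j <= r)%N) ->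
     pseudo_lifting_matrix A ->
     distinct_entry_spans A ->
     generic_entries A ->
     line_configuration (complete_pseudo_grid A l) /\
     seminormal (complete_pseudo_grid A l)).
Proof.
split=> [l A|l r A l_gt0 _ _ _ gen]; first exact: complete_grid_not_seminormal.
split; first exact: pseudo_grid_line_configuration.
exact: pseudo_grid_seminormal.
Qed.
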